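(* Let $G$ be a compactly generated locally compact second countable (lcsc) group and let $\Lambda\subset G$ be a uniform approximate lattice. Then $\Lambda$ is metrically amenable with respect to (any metric in) its canonical QI class if and only if $G$ is amenable as a lcsc group.
   Context: Approximate subgroup: a subset $\Lambda$ of a group $G$ which is symmetric ($\Lambda=\Lambda^{-1}$), contains the identity, and for which there is a finite set $F\subset\Lambda^\infty$ with $\Lambda^2\subset F\Lambda$, where $\Lambda^\infty$ is the subgroup generated by $\Lambda$ and $\Lambda^2=\{xy: x,y\in\Lambda\}$. In a metric space $(X,d)$, a subset $\Lambda$ is uniformly discrete if there is $r>0$ with $d(x,y)\ge r$ for all distinct $x,y\in\Lambda$; relatively dense if there is $R>0$ such that every point of $X$ is at distance $<R$ from some point of $\Lambda$; a Delone set if it is non-empty and has both properties. In a lcsc group these notions are taken with respect to any proper left-invariant metric inducing the topology (they do not depend on the choice). A uniform approximate lattice in $G$ is an approximate subgroup which is a Delone set. If $G$ is compactly generated and $\Lambda\subset G$ is a uniform approximate lattice, then $\Lambda^\infty$ is finitely generated; the canonical QI class of $\Lambda$ is the quasi-isometry class of the restrictions to $\Lambda$ of the left-invariant word metrics on $\Lambda^\infty$ with respect to finite generating sets (these restrictions are pairwise quasi-isometric via the identity map). A finite non-empty subset $F$ of a proper discrete metric space $(\Lambda,d)$ is an $(R,\epsilon)$-F\o lner set if $|\{x\in\Lambda : \max\{d(x,F),d(x,\Lambda\setminus F)\}<R\}|/|F|<\epsilon$. $(\Lambda,d)$ is metrically amenable if it admits an $(R,\epsilon)$-F\o lner set for all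 $R>0$ and $\epsilon>0$. A general metric space is metrically amenable if it admits a metrically amenable Delone subset. Convention: the distance from a point to the empty set is $+\infty$. *)

(* Defs.v *)
From HB Require Import structures.
From mathcomp Require Import all_boot all_order all_algebra finmap.
From mathcomp Require Import all_classical all_reals all_analysis.

Set Implicit Arguments.
Unset Strict Implicit.
Unset Printing Implicit Defensive.

Import Order.TTheory GRing.Theory Num.Theory.

Local Open Scope classical_set_scope.
Local Open Scope ring_scope.

(** * Topological groups *)

HB.structure Definition PreTopologicalGroup :=
  {G of Topological G & Group G}.

HB.mixin Record PreTopologicalGroup_isTopologicalGroup G
    & PreTopologicalGroup G := {
  mulg_continuous : continuous (fun x : G * G => (x.1 * x.2)%g) ;
  invg_continuous : continuous (fun x : G => (x^-1)%g)
}.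

#[short(type="topologicalGroupType")]
HB.structure Definition TopologicalGroup :=
  {G of PreTopologicalGroup G & PreTopologicalGroup_isTopologicalGroup G}.

(* Local compactness includes the Hausdorff axiom, as usual for groups. *)
Definition lcsc (G : topologicalGroupType) :=
  [/\ hausdorff_space G, locally_compact [set: G] & @second_countable G].

(** * Subsets of groups *)

Section GroupSubsets.
Variable G : groupType.
Implicit Types A B L S : set G.

Definition setmulg A B : set G := [set (x * y)%g | x in A & y in B].

Definition setinvg A : set G := [set (x^-1)%g | x in A].

Definition is_subgroup A :=
  [/\ A 1%g, (forall x y, A x -> A y -> A (x * y)%g) &
      forall x, A x -> A (x^-1)%g].

Definition generated A : set G := smallest is_subgroup A.

Definition approximate_subgroup L :=
  [/\ setinvg L = L, L 1%g &
      exists F : set G, [/\ finite_set F, F `<=` generated L &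
        setmulg L L `<=` setmulg F L]].

Definition is_word S n (g : G) :=
  exists s : seq G, [/\ size s = n,
    (forall x, x \in s -> (S `|` setinvg S) x) & g = (\prod_(x <- s) x)%g].

(* The infimum is a minimum when [g] lies in [generated S]; it has the junk
   value 0 otherwise. *)
Definition word_length (R : realType) S (g : G) : R :=
  inf [set n%:R | n in [set n | is_word S n g]].

Definition word_metric (R : realType) S (x y : G) : R :=
  word_length R S (x^-1 * y)%g.

End GroupSubsets.

Definition compactly_generated (G : topologicalGroupType) :=
  exists2 K : set G, compact K & generated K = [set: G].

(** * Metric spaces

   Several metrics on one set are compared below, so a metric space is given
   as a subset [A] of a type [T] with a function [d : T -> T -> R] of which
   only the values on [A] matter. *)

Section MetricSpaces.
Variable R : realType.

Definition is_metric_on T (A : set T) (d : T -> T -> R) :=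
  [/\ forall x y, A x -> A y -> 0 <= d x y,
      forall x y, A x -> A y -> d x y = 0 <-> x = y,
      forall x y, A x -> A y -> d x y = d y x &
      forall x y z, A x -> A y -> A z -> d x z <= d x y + d y z].

Definition uniformly_discrete T (d : T -> T -> R) (D : set T) :=
  exists2 r, 0 < r & forall x y, D x -> D y -> x <> y -> r <= d x y.

Definition relatively_dense T (A : set T) (d : T -> T -> R) (D : set T) :=
  exists2 r, 0 < r & forall x, A x -> exists2 y, D y & d x y < r.

Definition delone T (A : set T) (d : T -> T -> R) (D : set T) :=
  [/\ D `<=` A, D !=set0, uniformly_discrete d D & relatively_dense A d D].

Definition quasi_isometry T U (A : set T) (dA : T -> T -> R)
    (B : set U) (dB : U -> U -> R) (f : T -> U) :=
  f @` A `<=` B /\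
  exists K C : R, [/\ 1 <= K, 0 <= C,
    forall x y, A x -> A y ->
      K^-1 * dA x y - C <= dB (f x) (f y) <= K * dA x y + C &
    forall y, B y -> exists2 x, A x & dB y (f x) <= C].

(* Closed balls are compact, i.e. finite since the space is discrete;
   conversely, finiteness of all balls implies discreteness. *)
Definition proper_discrete T (A : set T) (d : T -> T -> R) :=
  forall x r, A x -> finite_set [set y | A y /\ d x y <= r].

(* [ereal_inf set0 = +oo]: the distance to the empty set is infinite. *)
Definition dist_to_set T (d : T -> T -> R) (x : T) (B : set T) : \bar R :=
  ereal_inf [set (d x y)%:E | y in B].

Definition folner_boundary T (A : set T) (d : T -> T -> R) (r : R)
    (F : set T) : set T :=
  [set x | A x /\
    (Order.max (dist_to_set d x F) (dist_to_set d x (A `\` F)) < r%:E)%E].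

(* [fset_set] sends infinite sets to the empty one, hence the requirement
   that the boundary be finite. *)
Definition folner_set (T : choiceType) (A : set T) (d : T -> T -> R)
    (r eps : R) (F : set T) :=
  [/\ F `<=` A, finite_set F, F !=set0,
      finite_set (folner_boundary A d r F) &
      (#|` fset_set (folner_boundary A d r F)|)%:R / (#|` fset_set F|)%:R
        < eps].

Definition folner_amenable (T : choiceType) (A : set T) (d : T -> T -> R) :=
  forall r eps : R, 0 < r -> 0 < eps -> exists F, folner_set A d r eps F.

Definition metrically_amenable (T : choiceType) (A : set T)
    (d : T -> T -> R) : Prop :=
  if `[< proper_discrete A d >] then folner_amenable A d
  else exists D, [/\ delone A d D, proper_discrete D d & folner_amenable D d].

End MetricSpaces.

(** * Uniform approximate lattices and their canonical QI class *)

Section UniformApproximateLattices.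
Variables (R : realType) (G : topologicalGroupType).

Definition induces_topology (d : G -> G -> R) :=
  forall (x : G) (A : set G),
    nbhs x A <-> exists2 r, 0 < r & [set y | d x y < r] `<=` A.

Definition left_invariant (d : G -> G -> R) :=
  forall g x y, d (g * x)%g (g * y)%g = d x y.

Definition proper_metric (d : G -> G -> R) :=
  forall x r, compact [set y | d x y <= r].

Definition admissible_metric (d : G -> G -> R) :=
  [/\ is_metric_on [set: G] d, induces_topology d, left_invariant d &
      proper_metric d].

(* Whether a set is Delone does not depend on the admissible metric. *)
Definition uniform_approximate_lattice (L : set G) :=
  approximate_subgroup L /\
  exists2 d, admissible_metric d & delone [set: G] d L.

(* The class consists of metrics on the set [L], compared by the identity.
   Under arbitrary quasi-isometries, metric amenability would not be invariant:
   it is sensitive to multiplicities in spaces whose balls of a given radius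
   are finite, but not of bounded cardinality. *)
Definition canonical_QI_class (L : set G) (d : G -> G -> R) :=
  is_metric_on L d /\
  exists S : set G, [/\ finite_set S, generated S = generated L &
    quasi_isometry L (word_metric R S) L d id].

End UniformApproximateLattices.

(** * Amenable groups *)

(* Measurable types are pointed in the library. *)
Definition pointed_group (G : topologicalGroupType) : Type := G.
HB.instance Definition _ (G : topologicalGroupType) :=
  Choice.on (pointed_group G).
HB.instance Definition _ (G : topologicalGroupType) :=
  isPointed.Build (pointed_group G) (1%g : G).

Definition borelType (G : topologicalGroupType) :=
  @g_sigma_algebraType (pointed_group G) (@open G).

Section Amenability.
Variables (R : realType) (G : topologicalGroupType).
Implicit Type mu : {measure set (borelType G) -> \bar R}.

(* On an lcsc group, Borel measures finite on compact sets are regular. *)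
Definition left_haar_measure mu :=
  [/\ (0 < mu setT)%E,
      forall K : set G, compact K -> (mu K < +oo)%E &
      forall (g : G) (A : set (borelType G)), measurable A ->
        mu [set (g * x)%g | x in (A : set G)] = mu A].

(* A functional on L^oo(G, mu) is given by its values on representatives;
   linearity and positivity force it to be constant on classes modulo
   mu-null sets. *)
Definition left_invariant_mean mu (m : (borelType G -> R) -> R) :=
  [/\ forall (a : R) f h, f \in Lfun mu +oo%E -> h \in Lfun mu +oo%E ->
        m (a *: f + h) = a * m f + m h,
      forall f, f \in Lfun mu +oo%E ->
        {ae mu, forall x, 0 <= f x} -> 0 <= m f,
      m (cst 1) = 1 &
      forall (g : G) f, f \in Lfun mu +oo%E ->
        m (fun x => f ((g^-1 * x)%g : G)) = m f].

Definition amenable :=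
  exists2 mu, left_haar_measure mu & exists m, left_invariant_mean mu m.

End Amenability.

(* Main.v *)
(* Write L for the approximate lattice. As L L is covered by finitely many
   translates of L, it is locally finite; hence any metric in the canonical QI
   class is coarsely equivalent, on L, to a proper left-invariant metric of G,
   and metric amenability of L is the existence of Folner sets on a large scale.

   If F is a Folner set of L and Q a ball with G = Q L, then W = Q F^-1 satisfies
   mu (g W \ W) + mu (W \ g W) <= C^3 eps mu W for a left Haar measure mu, because
   mu (Q x^-1) is bounded above and below uniformly in x: L being symmetric,
   left and right translates of Q by L both have bounded multiplicity. Averages
   over such sets converge along an ultrafilter to an invariant mean.

   Conversely, an invariant mean m gives weights M A = m (y |-> |A /\ y^-1 Q|) to
   the subsets A of L, and double counting yields M (A e) <= C M A whenever A and
   A e lie in L, with C independent of A and e. If L had no Folner sets, finite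
   subsets would expand by an arbitrarily large factor N within bounded distance,
   and Hall's marriage theorem would give N injections of L into itself with
   disjoint images and bounded displacement, hence N M L <= C M L, which is
   absurd for N > C since M L >= 1. *)

Require Import Defs.
From HB Require Import structures.
From mathcomp Require Import all_boot all_order all_algebra finmap.
From mathcomp Require Import all_classical all_reals all_analysis.
From mathcomp Require Import ess_sup_inf measurable_realfun ring lra zify.

Set Implicit Arguments.
Unset Strict Implicit.
Unset Printing Implicit Defensive.

Import Order.TTheory GRing.Theory Num.Theory.
Import numFieldNormedType.Exports.

Local Open Scope classical_set_scope.
Local Open Scope ring_scope.

(** * Limits along an ultrafilter *)

Lemma nat_ultrafilter_ex :
  exists F : set_system nat, UltraFilter F /\ \oo `<=` F.
Proof. exact: ultraFilterLemma. Qed.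

(** One free ultrafilter is fixed, so that all bounded sequences have limits at once and these
    depend linearly on the sequence. It serves the matching of infinite families, the Haar content
    and the invariant mean. *)
Definition nat_ultra : set_system nat := sval (cid nat_ultrafilter_ex).

#[global] Instance nat_ultra_ultra : UltraFilter nat_ultra.
Proof. by case: (svalP (cid nat_ultrafilter_ex)). Qed.

Lemma nat_ultra_oo : \oo `<=` nat_ultra.
Proof. by case: (svalP (cid nat_ultrafilter_ex)). Qed.

Section UltraLimit.
Variable R : realType.
Implicit Types u v : nat -> R.

Definition useq_bounded u := exists M, forall n, `|u n| <= M.

Definition ulim u : R := lim (u @ nat_ultra).

(** The image of an ultrafilter is again an ultrafilter; it contains the compact segment [-M, M],
    hence it converges. *)
Lemma cvg_ulim u : useq_bounded u -> u @ nat_ultra --> ulim u.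
Proof.
move=> [M uM].
have UF : UltraFilter (u @ nat_ultra).
  split; first exact: fmap_proper_filter.
  move=> G PG uG; rewrite eqEsubset; split=> // A GA.
  have [//|nA] := in_ultra_setVsetC (u @^-1` A) nat_ultra_ultra.
  have GnA : G (~` A) by apply: uG.
  have G0 : G set0 by rewrite -(setICr A); apply: filterI.
  by case: (@filter_not_empty _ G PG G0).
have := @segment_compact R (- M) M; rewrite compact_ultra.
case/(_ (u @ nat_ultra) UF).
  apply: (@filterE _ nat_ultra) => n /=; move: (uM n).
  by rewrite in_itv /= ler_norml.
by move=> l [_ /= ul]; apply/cvg_ex; exists l.
Qed.

Lemma ulim_eq u l : u @ nat_ultra --> l -> ulim u = l.
Proof. by move=> ul; apply: cvg_lim. Qed.

Lemma ulim_cvg u l : u @ \oo --> l -> ulim u = l.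
Proof.
move=> ul; apply: ulim_eq; apply: cvg_trans ul.
by move=> A /= /nat_ultra_oo.
Qed.

Lemma ulim_cst (a : R) : ulim (fun=> a) = a.
Proof. by apply: ulim_eq; apply: cvg_cst. Qed.

Lemma ulim_le u v : useq_bounded u -> useq_bounded v ->
  (\forall n \near \oo, u n <= v n) -> ulim u <= ulim v.
Proof.
move=> /cvg_ulim cu /cvg_ulim cv uv.
by apply: ler_cvg_to cu cv _; apply: nat_ultra_oo uv.
Qed.

Lemma ulimD u v : useq_bounded u -> useq_bounded v ->
  ulim (fun n => u n + v n) = ulim u + ulim v.
Proof.
by move=> /cvg_ulim cu /cvg_ulim cv; apply: ulim_eq; apply: cvgD.
Qed.

Lemma ulimZ a u : useq_bounded u -> ulim (fun n => a * u n) = a * ulim u.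
Proof. by move=> /cvg_ulim cu; apply: ulim_eq; apply: cvgMr. Qed.

Lemma useq_boundedD u v : useq_bounded u -> useq_bounded v ->
  useq_bounded (fun n => u n + v n).
Proof.
move=> [M uM] [N vN]; exists (M + N) => n.
by rewrite (le_trans (ler_normD _ _))// lerD.
Qed.

Lemma useq_boundedZ a u : useq_bounded u -> useq_bounded (fun n => a * u n).
Proof.
by move=> [M uM]; exists (`|a| * M) => n; rewrite normrM ler_wpM2l.
Qed.

Lemma useq_bounded_cst (a : R) : useq_bounded (fun=> a).
Proof. by exists `|a|. Qed.

End UltraLimit.

(** * Hall's marriage theorem *)

Section Hall.
Local Open Scope fset_scope.
Local Open Scope nat_scope.
Variables T U : choiceType.
Implicit Types (nb : T -> {fset U}) (A B C : {fset T}).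

Definition nbhd nb A : {fset U} := \bigcup_(x <- A) nb x.

Lemma nbhdP nb A y :
  reflect (exists2 x, x \in A & y \in nb x) (y \in nbhd nb A).
Proof.
apply: (iffP (bigfcupP _ _ _ _)) => [[x]|[x xA yx]].
  by rewrite andbT => xA yx; exists x.
by exists x; rewrite ?xA.
Qed.

(** Induction on the size of [A], after Halmos and Vaughan. Either some nonempty proper [B] is
    tight, and [B] and its complement are matched separately, or every nonempty proper subset has a
    spare neighbour, and one pair can be matched at will. *)
Theorem hall (u0 : U) nb A :
  (forall B, B `<=` A -> #|` B| <= #|` nbhd nb B|) ->
  exists f : T -> U, {in A, forall x, f x \in nb x} /\ {in A &, injective f}.
Proof.
move: {2}_.+1 (ltnSn #|` A|) => n; elim: n nb A => // n IHn nb A An hallA.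
have [A0|/fset0Pn[a aA]] := eqVneq A fset0.
  by exists (fun=> u0); split=> x; rewrite A0 inE.
have [[B [BA B0 tightB]]|ntight] := pselect (exists B,
    [/\ B `<` A, B != fset0 & #|` nbhd nb B| = #|` B|]).
  have BsA : B `<=` A by apply: fproper_sub.
  have ltBA := fproper_ltn_card BA.
  have B_gt0 : 0 < #|` B| by rewrite cardfs_gt0.
  have [] := IHn nb B; first by lia.
    by move=> C CB; apply: hallA; apply: fsubset_trans BsA.
  move=> f [fnb finj].
  (* The neighbours of [B] are reserved. Hall's condition survives for [C] outside [B]: apply it to
     the union of [C] and [B] and subtract the equality for the tight [B]. *)
  have [] := IHn (fun x => nb x `\` nbhd nb B) (A `\` B).
  - by have := cardfsD A B; rewrite (fsetIidPr BsA); lia.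
  - move=> C /fsubsetP CAB.
    have CB0 : C `&` B = fset0.
      by apply/fsetP => x; rewrite !inE; apply/negP => /andP[/CAB];
        rewrite !inE => /andP[/negP].
    have /hallA : C `|` B `<=` A.
      by apply/fsubsetP => x; rewrite inE => /orP[/CAB|/(fsubsetP BsA)//];
        rewrite inE => /andP[].
    rewrite cardfsU CB0 cardfs0 subn0 => leCB.
    suff : nbhd nb (C `|` B) `<=`
        nbhd (fun x => nb x `\` nbhd nb B) C `|` nbhd nb B.
      by move=> /fsubset_leq_card; rewrite cardfsU; lia.
    apply/fsubsetP => y /nbhdP[x]; rewrite inE => /orP[xC|xB] yx; rewrite in_fsetU; last first.
      by apply/orP; right; apply/nbhdP; exists x.
have [yB|yB] := boolP (y \in nbhd nb B); apply/orP; first by right.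
    by left; apply/nbhdP; exists x => //; rewrite inE yB.
  move=> g [gnb ginj]; exists (fun x => if x \in B then f x else g x).
  have gAB x : x \in A -> x \notin B -> g x \in nb x `\` nbhd nb B.
    by move=> xA xB; apply: gnb; rewrite inE xA xB.
  split=> [x xA|x y xA yA].
    by case: ifPn => [/fnb//|/(gAB _ xA)]; rewrite inE => /andP[].
  case: ifPn => xB; case: ifPn => yB.
  - exact: finj.
  - move=> fg; have := gAB _ yA yB; rewrite in_fsetD -fg => /andP[/negP[]].
    by apply/nbhdP; exists x => //; apply: fnb.
  - move=> fg; have := gAB _ xA xB; rewrite in_fsetD fg => /andP[/negP[]].
    by apply/nbhdP; exists y => //; apply: fnb.
  - by apply: ginj; rewrite inE ?xA ?yA ?xB ?yB.
have hallA' B : B `<` A -> B != fset0 -> #|` B| < #|` nbhd nb B|.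
  move=> BA B0; rewrite ltn_neqAle hallA ?fproper_sub// andbT.
  by apply/eqP => tightB; apply: ntight; exists B.
have [b ba] : exists b, b \in nb a.
  have := hallA [fset a]; rewrite fsub1set aA cardfs1 => /(_ isT).
  rewrite cardfs_gt0 => /fset0Pn[b /nbhdP[x]].
  by rewrite inE => /eqP ->; exists b.
have Aa : A `\ a `<` A by rewrite fproperD1.
(* Removing [b] costs each subset at most one neighbour, which the strict inequality [hallA'] pays
   for. *)
have [] := IHn (fun x => nb x `\ b) (A `\ a).
- by have := fproper_ltn_card Aa; lia.
- move=> C CAa; have [->|C0] := eqVneq C fset0; first by rewrite cardfs0.
  have := hallA' C (fsub_proper_trans CAa Aa) C0.
  suff /fsubset_leq_card : nbhd nb C `<=` b |` nbhd (fun x => nb x `\ b) C.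
    by rewrite cardfsU1; lia.
  apply/fsubsetP => y /nbhdP[x xC yx]; rewrite !inE.
  have [//|yb] := eqVneq y b; apply/nbhdP; exists x => //.
  by rewrite !inE yb.
move=> f [fnb finj]; exists (fun x => if x == a then b else f x).
have fAa x : x \in A -> x != a -> (f x != b) && (f x \in nb x).
  by move=> xA xa; have := fnb x; rewrite !inE xa => /(_ xA).
split=> [x xA|x y xA yA].
  by case: eqVneq => [->//|/(fAa _ xA)/andP[]].
case: eqVneq => [->|xa]; case: eqVneq => [->//|ya] fxy.
- by have := fAa _ yA ya; rewrite -fxy eqxx.
- by have := fAa _ xA xa; rewrite fxy eqxx.
- by apply: finj => //; rewrite !inE ?xa ?ya.
Qed.

End Hall.

Section UltraMatching.
Variables T U : choiceType.

Lemma ultra_seq (h : nat -> U) (s : seq U) :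
  nat_ultra [set n | h n \in s] -> exists2 y, y \in s & nat_ultra [set n | h n = y].
Proof.
elim: s => [|y s IHs] hs.
  suff : nat_ultra set0 by move/filter_not_empty.
  by move: hs; congr (nat_ultra _); apply/seteqP; split.
have [hy|hy] := in_ultra_setVsetC [set n | h n = y] nat_ultra_ultra.
  by exists y => //; rewrite mem_head.
have [|z] := IHs.
  by apply: filterS2 hs hy => n /=; rewrite inE => /orP[/eqP//|//].
by move=> zs hz; exists z => //; rewrite inE zs orbT.
Qed.

(** Match each finite [X n] separately by some [f n]. As [nb x] is finite, the value [f n x] is
    constant for almost all n along the ultrafilter, and this value is the limit matching. Two
    points share an index n at which both limit values are attained, which gives injectivity. *)
Theorem hall_exhausted (u0 : U) (nb : T -> {fset U}) (P : set T)
    (X : nat -> {fset T}) :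
  (forall n x, x \in X n -> P x) ->
  (forall x, P x -> \forall n \near \oo, x \in X n) ->
  (forall B : {fset T}, (forall x, x \in B -> P x) ->
     (#|` B| <= #|` nbhd nb B|)%N) ->
  exists f : T -> U, (forall x, P x -> f x \in nb x) /\
    (forall x y, P x -> P y -> f x = f y -> x = y).
Proof.
move=> XP XE hallP.
have /choice[f fP] n : exists f : T -> U,
    {in X n, forall x, f x \in nb x} /\ {in X n &, injective f}.
  apply: hall => // B /fsubsetP BX; apply: hallP => x /BX; exact: XP.
have /choice[g gP] x : exists y, P x ->
    y \in nb x /\ nat_ultra [set n | f n x = y].
  have [Px|Px] := pselect (P x); last by exists u0.
  have [|y yx fy] := @ultra_seq (f^~ x) (nb x); last by exists y.
  apply: filterS (nat_ultra_oo (XE x Px)) => n /= xX.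
  by case: (fP n) => + _; apply.
exists g; split=> [x /gP[]//|x y Px Py gxy].
have [_ gx] := gP x Px; have [_ gy] := gP y Py.
have : nat_ultra [set n | [/\ f n x = g x, f n y = g y, x \in X n & y \in X n]].
  near=> n; split; near: n => //; exact/nat_ultra_oo/XE.
move/filter_ex => [n /= [fx fy xX yX]]; case: (fP n) => _; apply=> //.
by rewrite fx fy.
Unshelve. all: by end_near. Qed.

End UltraMatching.

(** * Word metrics *)

Section Words.
Variables (R : realType) (G : groupType) (S : set G).
Implicit Types (g x y : G) (n : nat).

Definition word_ball n : set G := [set g | exists2 k, (k <= n)%N & is_word S k g].

Lemma is_word1 : is_word S 0 (1%g : G).
Proof. by exists [::]; split=> //; rewrite big_nil. Qed.

Lemma is_wordM m n x y :
  is_word S m x -> is_word S n y -> is_word S (m + n) (x * y)%g.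
Proof.
move=> [s [<- sS ->]] [t [<- tS ->]]; exists (s ++ t); split.
- by rewrite size_cat.
- by move=> z; rewrite mem_cat => /orP[/sS|/tS].
- by rewrite big_cat.
Qed.

Lemma is_wordV n x : is_word S n x -> is_word S n (x^-1)%g.
Proof.
move=> [s [<- sS ->]]; exists (rev [seq (z^-1)%g | z <- s]); split.
- by rewrite size_rev size_map.
- move=> z; rewrite mem_rev => /mapP[t /sS[St|[u Su <-]] ->]; [right|left].
    by exists t.
  by rewrite invgK.
- by rewrite -map_rev big_map prodgV revK.
Qed.

Lemma word_ball1 n : word_ball n 1%g.
Proof. by exists 0%N => //; exact: is_word1. Qed.

Lemma word_ballM m n x y :
  word_ball m x -> word_ball n y -> word_ball (m + n) (x * y)%g.
Proof.
move=> [k km xk] [l ln yl]; exists (k + l)%N; first exact: leq_add.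
exact: is_wordM.
Qed.

Lemma word_ballV n x : word_ball n x -> word_ball n (x^-1)%g.
Proof. by move=> [k kn xk]; exists k => //; exact: is_wordV. Qed.

Lemma generated_word g : generated S g <-> exists n, is_word S n g.
Proof.
split=> [genSg|[n [s [_ sS ->]]] A [[A1 AM AV] SA]].
  apply: (genSg [set g | exists n, is_word S n g]); split=> [|x Sx].
    split; first by exists 0%N; exact: is_word1.
      by move=> x y [m xm] [n yn]; exists (m + n)%N; exact: is_wordM.
    by move=> x [n xn]; exists n; exact: is_wordV.
  exists 1%N, [:: x]; split=> //; last by rewrite big_seq1.
  by move=> z; rewrite inE => /eqP ->; left.
rewrite big_seq; apply: (big_ind A A1 AM) => x /sS[/SA//|[y Sy <-]].
by apply: AV; exact: SA.
Qed.

Lemma finite_word_ball n : finite_set S -> finite_set (word_ball n).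
Proof.
move=> finS; pose S' := S `|` setinvg S.
have finS' : finite_set S' by rewrite finite_setU; split=> //; exact: finite_image.
elim: n => [|n IHn].
  apply: (sub_finite_set _ (finite_set1 (1%g : G))) => x [k].
  by rewrite leqn0 => /eqP -> [s [/size0nil -> _ ->]]; rewrite big_nil.
have : finite_set (word_ball n `|` [set (x * y)%g | x in S' & y in word_ball n]).
  by rewrite finite_setU; split=> //; exact: finite_image2.
move=> fin; apply: sub_finite_set fin => x [k kn [s [sk sS ->]]].
case: s => [|z s] in sk sS *.
  by left; rewrite big_nil; exact: word_ball1.
right; rewrite big_cons; exists z; first by apply: sS; rewrite mem_head.
exists (\prod_(i <- s) i)%g => //; exists (size s).
  by move: kn; rewrite -sk.
by exists s; split=> // y ys; apply: sS; rewrite inE ys orbT.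
Qed.

(** For g in [generated S] the infimum runs over a nonempty set of naturals and its least element is
    a lower bound, so some word has length at most c. Then c is nonnegative, and the absolute value
    of its floor changes nothing. *)
Lemma word_length_ball (c : R) g : generated S g -> word_length R S g <= c ->
  word_ball `|Num.floor c|%N g.
Proof.
move=> /generated_word[n0 gn0] lec.
have ex_n : exists n, `[< is_word S n g >] by exists n0; exact/asboolP.
have [n /asboolP gn nmin] := ex_minnP ex_n.
exists n => //; have : n%:R <= c.
  apply: le_trans lec; apply: lb_le_inf; first by exists n0%:R, n0.
  by move=> _ [m /= gm <-]; rewrite ler_nat; apply: nmin; exact/asboolP.
rewrite -[n%:R]/((n%:Z)%:~R) -floor_ge_int ?num_real//; move: (Num.floor c) => z nz; lia.
Qed.

End Words.

Lemma generated_subgroup (G : groupType) (A : set G) : is_subgroup (generated A).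
Proof.
split=> [B [[B1 _ _] _]//|x y Ax Ay B [BG AB]|x Ax B [BG AB]].
  by case: (BG) => _ BM _; apply: BM; [apply: Ax|apply: Ay].
by case: (BG) => _ _; apply; apply: Ax.
Qed.

Lemma generated_sub (G : groupType) (A : set G) : A `<=` generated A.
Proof. exact: sub_smallest. Qed.

(** * Comparison of a metric of the canonical class with finite subsets of the group *)

Section Coarse.
Variables (R : realType) (G : topologicalGroupType) (L : set G) (S : set G).
Variable d : G -> G -> R.
Hypotheses (finS : finite_set S) (genS : generated S = generated L).
Hypothesis QId : quasi_isometry L (word_metric R S) L d id.

Lemma generated_div x y : L x -> L y -> generated S (x^-1 * y)%g.
Proof.
move=> Lx Ly; rewrite genS; have [_ GM GV] := generated_subgroup L.
by apply: GM; [apply: GV|]; exact: generated_sub.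
Qed.

Lemma QI_word_ball (r : R) : exists n, forall x y, L x -> L y -> d x y <= r ->
  word_ball S n (x^-1 * y)%g.
Proof.
have [_ [K [C [K1 C0 KC _]]]] := QId.
exists `|Num.floor (K * (r + C))|%N => x y Lx Ly dr.
apply: (@word_length_ball R); first exact: generated_div.
have K0 : 0 < K by lra.
have /andP[+ _] := KC x y Lx Ly; rewrite -/(word_metric R S x y).
by rewrite lerBlDr ler_pdivrMl// => /le_trans; apply; rewrite ler_wpM2l; lra.
Qed.

(** Word length is bounded on a finite set, and the upper quasi-isometry inequality transfers the
    bound to [d]. With [E] a bounded piece of L L, this controls [d] by the metric of G. *)
Lemma QI_finite (E : set G) : finite_set E ->
  exists2 r : R, 0 < r & forall x y, L x -> L y -> E (x^-1 * y)%g -> d x y < r.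
Proof.
move=> finE; have [_ [K [C [K1 C0 KC _]]]] := QId.
have [M ME] : exists M, forall g, E g -> word_length R S g <= M.
  exists (\sum_(g <- fset_set E) `|word_length R S g|) => g Eg.
  have gE : g \in fset_set E by rewrite in_fset_set// inE.
  rewrite (big_rem g)//= (le_trans (ler_norm _))// lerDl.
  exact: sumr_ge0.
exists (`|K * M + C| + 1) => [|x y Lx Ly Exy]; first by rewrite ltr_wpDl.
have /andP[_ +] := KC x y Lx Ly => /le_lt_trans; apply.
have := ler_norm (K * M + C); have : K * word_metric R S x y <= K * M.
  by rewrite ler_wpM2l ?ME//; lra.
by lra.
Qed.

Lemma QI_proper_discrete : proper_discrete L d.
Proof.
move=> x r Lx; have [n nP] := QI_word_ball r.
have := finite_image (fun g => (x * g)%g) (finite_word_ball n finS).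
apply: sub_finite_set => y [Ly dr]; exists (x^-1 * y)%g; first exact: nP.
by rewrite mulVKg.
Qed.

Lemma QI_metrically_amenable : metrically_amenable L d <-> folner_amenable L d.
Proof.
by rewrite /metrically_amenable; case: asboolP => // -[]; exact: QI_proper_discrete.
Qed.

End Coarse.

(** * Admissible metrics and Delone sets *)

HB.instance Definition _ (G : topologicalGroupType) :=
  Topological.copy (pointed_group G) G.

Lemma group_compact_cover (G : topologicalGroupType) (K : set G) :
  compact K -> cover_compact K.
Proof.
by move=> cK; rewrite -(@compact_cover (pointed_group G)).
Qed.

Section AdmissibleMetric.
Variables (R : realType) (G : topologicalGroupType) (d : G -> G -> R).
Hypothesis admd : admissible_metric d.
Implicit Types (x y z g : G) (r : R).

Let metric_d : is_metric_on [set: G] d. Proof. by case: admd. Qed.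
Let topology_d : induces_topology d. Proof. by case: admd. Qed.
Let invariant_d : left_invariant d. Proof. by case: admd. Qed.

Lemma adm_ge0 x y : 0 <= d x y. Proof. by case: metric_d => + _ _ _; apply. Qed.
Lemma adm_sym x y : d x y = d y x. Proof. by case: metric_d => _ _ + _; apply. Qed.
Lemma adm_eq0 x y : d x y = 0 <-> x = y.
Proof. by case: metric_d => _ + _ _; apply. Qed.
Lemma admxx x : d x x = 0. Proof. exact/adm_eq0. Qed.
Lemma adm_triangle y x z : d x z <= d x y + d y z.
Proof. by case: metric_d => _ _ _ +; apply. Qed.
Lemma admMl g x y : d (g * x)%g (g * y)%g = d x y.
Proof. exact: invariant_d. Qed.

Definition dnorm x : R := d 1%g x.

Lemma admE x y : d x y = dnorm (x^-1 * y)%g.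
Proof. by rewrite /dnorm -(admMl x 1%g) mulg1 mulVKg. Qed.

Lemma dnormV x : dnorm (x^-1)%g = dnorm x.
Proof. by rewrite /dnorm -(admMl x 1%g (x^-1)%g) mulg1 mulgV adm_sym. Qed.

Lemma dnormM x y : dnorm (x * y)%g <= dnorm x + dnorm y.
Proof. by rewrite (le_trans (adm_triangle x _ _))// lerD2l admE mulKg. Qed.

Definition dball r : set G := [set z | dnorm z < r].

Lemma nbhs_adm x (A : set G) :
  nbhs x A <-> exists2 r, 0 < r & forall y, d x y < r -> A y.
Proof. exact: topology_d. Qed.

Lemma open_adm (A : set G) :
  (forall x, A x -> exists2 r, 0 < r & forall y, d x y < r -> A y) -> open A.
Proof. by move=> AP; rewrite openE => x /AP ?; apply/nbhs_adm. Qed.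

Lemma open_admP (A : set G) : open A ->
  forall x, A x -> exists2 r, 0 < r & forall y, d x y < r -> A y.
Proof. by move=> oA x Ax; apply/nbhs_adm; apply: open_nbhs_nbhs. Qed.

Lemma open_adm_ball x r : open [set y | d x y < r].
Proof.
apply: open_adm => y /= xy; exists (r - d x y); first by rewrite subr_gt0.
by move=> z yz; have := adm_triangle y x z; lra.
Qed.

Lemma open_dball r : open (dball r). Proof. exact: open_adm_ball. Qed.

Lemma compact_adm_ball x r : compact [set y | d x y <= r].
Proof. by case: admd => _ _ _; apply. Qed.

Lemma dball_sym r x : dball r (x^-1)%g <-> dball r x.
Proof. by rewrite /dball /= dnormV. Qed.

Lemma totally_bounded_ball (r s : R) : 0 < s ->
  exists F : {fset G}, forall x, dnorm x <= r -> exists2 c, c \in F & d c x < s.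
Proof.
move=> s0; have /group_compact_cover := @compact_adm_ball 1%g r.
move=> /(_ G setT (fun c => [set x | d c x < s])) [].
- by move=> c _; exact: open_adm_ball.
- by move=> x _; exists x => //=; rewrite admxx.
- by move=> F _ Fcov; exists F => x /Fcov[c]; exists c.
Qed.

Lemma compact_bounded (K : set G) : compact K -> exists r, K `<=` dball r.
Proof.
move=> /group_compact_cover /(_ G setT (fun c => [set x | d c x < 1])) [].
- by move=> c _; exact: open_adm_ball.
- by move=> x _; exists x => //=; rewrite admxx.
- move=> F _ Fcov; exists (\sum_(c <- F) dnorm c + 1) => x /Fcov[c /= cF dcx].
  apply: le_lt_trans (adm_triangle c _ _) _; rewrite ler_ltD//.
  by rewrite (big_rem c)//= lerDl sumr_ge0// => z _; exact: adm_ge0.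
Qed.

End AdmissibleMetric.

(** * Points of a Delone set in translates of a ball *)

Section Window.
Variables (R : realType) (G : topologicalGroupType) (d : G -> G -> R).
Hypothesis admd : admissible_metric d.
Variable L : set G.
Hypotheses (deloneL : delone [set: G] d L) (symL : setinvg L = L).

Lemma symLV x : L x -> L (x^-1)%g.
Proof. by move=> Lx; rewrite -symL; exists x. Qed.

(** The norm of g x is the distance from g^-1 to x, so this is relative density at g^-1. *)
Lemma window_cover : exists2 r : R, 0 < r &
  forall g, exists2 x, L x & dball d r (g * x)%g.
Proof.
have [_ _ _ [r r0 rP]] := deloneL; exists r => // g.
have [//|x Lx dx] := rP (g^-1)%g; exists x => //.
by rewrite /dball /= -{1}(invgK g) -admE.
Qed.

(** Cover the r-ball by finitely many balls of half the separation s of L. Left translation by g is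
    an isometry, so each small ball contains g x for at most one x in L; the number of small balls
    is then a bound that does not depend on g. *)
Lemma window_count (r : R) : exists C, forall g, exists F : {fset G},
  (#|` F| <= C)%N /\ forall x, L x -> dball d r (g * x)%g -> x \in F.
Proof.
have [_ _ [s s0 sP] _] := deloneL.
have s2 : 0 < s / 2 by rewrite divr_gt0.
have [F0 F0P] := totally_bounded_ball admd r s2.
exists #|` F0| => g.
(* [h c] is the point of L that g sends into the small ball at c, and 1 if there is none. *)
have /choice[h hP] c : exists x, forall y, L y -> d c (g * y)%g < s / 2 -> y = x.
  have [[x [Lx cx]]|nx] := pselect (exists x, L x /\ d c (g * x)%g < s / 2).
    exists x => y Ly cy; apply: contrapT => yx; have := sP _ _ Ly Lx yx.
    rewrite -(admMl admd g) => /le_gtF/negP; apply.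
    have := adm_triangle admd c (g * y)%g (g * x)%g.
    by rewrite (adm_sym admd (g * y)%g c); lra.
  by exists 1%g => y Ly cy; case: nx; exists y.
exists [fset h c | c in F0]%fset; split; first exact: leq_imfset_card.
move=> x Lx /ltW/F0P[c cF0 cx]; apply/imfsetP; exists c => //.
exact: hP.
Qed.

End Window.

Section MulContinuous.
Variable G : topologicalGroupType.

Lemma mulg_continuous_l (g : G) : continuous (fun y : G => (g * y)%g).
Proof.
move=> y; apply: (@continuous_comp _ _ _ (fun y : G => (g, y)) (fun p => p.1 * p.2)%g).
  by apply: cvg_pair; [exact: cvg_cst|exact: cvg_id].
exact: mulg_continuous.
Qed.

Lemma mulg_continuous_r (g : G) : continuous (fun y : G => (y * g)%g).
Proof.
move=> y; apply: (@continuous_comp _ _ _ (fun y : G => (y, g)) (fun p => p.1 * p.2)%g).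
  by apply: cvg_pair; [exact: cvg_id|exact: cvg_cst].
exact: mulg_continuous.
Qed.

Lemma open_mulgl (g : G) (A : set G) : open A -> open [set y | A (g * y)%g].
Proof. by move=> oA; apply: open_comp => // y _; exact: mulg_continuous_l. Qed.

Lemma open_mulgr (g : G) (A : set G) : open A -> open [set y | A (y * g)%g].
Proof. by move=> oA; apply: open_comp => // y _; exact: mulg_continuous_r. Qed.

End MulContinuous.

Section LocallyFinite.
Variables (R : realType) (G : topologicalGroupType) (d : G -> G -> R).
Hypothesis admd : admissible_metric d.
Variable L : set G.
Hypotheses (deloneL : delone [set: G] d L) (apxL : approximate_subgroup L).

Lemma finite_window (g : G) (r : R) : finite_set [set x | L x /\ dball d r (g * x)%g].
Proof.
have [C /(_ g)[F [_ FP]]] := window_count admd deloneL r.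
apply: sub_finite_set (finite_fset F) => x [Lx gx].
exact: FP.
Qed.

(** L L lies in F L with F finite, so a ball meets it in finitely many windows of L. *)
Lemma finite_window_mul (r : R) :
  finite_set [set z | setmulg L L z /\ dball d r z].
Proof.
have [_ _ [F [finF _ LLF]]] := apxL.
have fin : finite_set (\bigcup_(f in F)
    [set (f * x)%g | x in [set x | L x /\ dball d r (f * x)%g]]).
  apply: bigcup_finite => // f _; apply: finite_image; exact: finite_window.
apply: sub_finite_set fin => z [/LLF[f Ff [x Lx <-]] fx].
by exists f => //; exists x.
Qed.

End LocallyFinite.

(** * Invariant means *)

(** Cardinals are written as sums of indicators over a common finite set, so that double counting
    becomes an exchange of sums. *)
Lemma card_fset_set_sum (T : choiceType) (F : {fset T}) (P : set T) :
  (forall x, P x -> x \in F) ->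
  #|` fset_set P|%fset = (\sum_(x <- F) `[< P x >])%N.
Proof.
move=> PF; have finP : finite_set P by apply: sub_finite_set (finite_fset F).
transitivity (count (fun x => `[< P x >]) F); last first.
  by rewrite -sum1_count big_mkcond /=; apply: eq_bigr => x _; case: asboolP.
rewrite -size_filter; apply/perm_size/uniq_perm => //.
  by rewrite filter_uniq.
move=> x; rewrite mem_filter in_fset_set// unfold_in /=.
by apply/asboolP/andP => [Px|[/asboolP//]]; split; [exact/asboolP|exact: PF].
Qed.

Lemma sum_bool_ge1 (T : choiceType) (K : {fset T}) (P : T -> Prop) k :
  k \in K -> P k -> (1 <= \sum_(k <- K) `[< P k >])%N.
Proof.
move=> kK Pk; rewrite (big_rem k)//=.
by have -> : `[< P k >] by exact/asboolP.
Qed.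

Lemma sum_bool_le (T : choiceType) (K F : {fset T}) (P : T -> Prop) :
  (forall k, k \in K -> P k -> k \in F) ->
  (\sum_(k <- K) `[< P k >] <= #|` F|%fset)%N.
Proof.
move=> PF; have := @card_fset_set_sum _ K [set k | k \in K /\ P k] (fun _ => @proj1 _ _).
rewrite [X in _ = X]big_seq [X in _ = X](_ : _ = (\sum_(k <- K) `[< P k >])%N); last first.
  rewrite -big_seq; apply: eq_big_seq => k kK; congr (nat_of_bool _).
  by apply/asboolP/asboolP => [[]//|Pk]; split.
move=> <-; apply: fsubset_leq_card; apply/fsubsetP => k.
rewrite in_fset_set; last by apply: sub_finite_set (finite_fset K) => ? [].
by rewrite inE => -[]; exact: PF.
Qed.

Section Lfun_infty.
Variables (R : realType) (G : topologicalGroupType).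
Variable mu : {measure set (borelType G) -> \bar R}.

Lemma bounded_Lfun (f : borelType G -> R) (M : R) :
  measurable_fun setT f -> (forall x, `|f x| <= M) -> f \in Lfun mu +oo%E.
Proof.
move=> mf fM; rewrite inE; apply/andP; split; rewrite inE //=.
rewrite /finite_norm unlock; case: ifP => // _.
apply: (@le_lt_trans _ _ M%:E); last exact: ltry.
by apply/ess_supP; apply: aeW => x /=; rewrite lee_fin.
Qed.

Lemma Linfty_lin (a : R) (f h : borelType G -> R) :
  f \in Lfun mu +oo%E -> h \in Lfun mu +oo%E -> a *: f + h \in Lfun mu +oo%E.
Proof. by have [_] := @Lfun_submod_closed _ _ _ mu +oo%E (leey 1); apply. Qed.

Lemma Linfty_cst (a : R) : (cst a : borelType G -> R) \in Lfun mu +oo%E.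
Proof. by apply: (@bounded_Lfun _ `|a|) => //; exact: measurable_cst. Qed.

Lemma Linfty_sum (I : Type) (s : seq I) (f : I -> borelType G -> R) :
  (forall i, f i \in Lfun mu +oo%E) -> \sum_(i <- s) f i \in Lfun mu +oo%E.
Proof.
move=> fL; elim: s => [|i s IHs]; first by rewrite big_nil; exact: (Linfty_cst 0).
by rewrite big_cons -[f i]scale1r; exact: Linfty_lin.
Qed.

Lemma open_measurable_borel (A : set G) :
  open A -> measurable (A : set (borelType G)).
Proof. by move=> oA; apply: sub_sigma_algebra. Qed.

Lemma lower_semicontinuous_measurable (f : borelType G -> R) :
  (forall a, open ([set x : G | a < f x] : set G)) -> measurable_fun setT f.
Proof.
move=> fo mT; apply: (measurability _ (RGenOInfty.measurableE R)) => //.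
move=> /= _ [_ [a ->] <-]; rewrite setTI; apply: open_measurable_borel.
have := fo a; congr (open _).
by apply/seteqP; split=> x /=; rewrite in_itv /= andbT.
Qed.

End Lfun_infty.

Section Mean.
Variables (R : realType) (G : topologicalGroupType).
Variable mu : {measure set (borelType G) -> \bar R}.
Variable m : (borelType G -> R) -> R.
Hypothesis mean_m : left_invariant_mean mu m.
Local Notation Linfty := (Lfun mu +oo%E).

Lemma meanD f h : f \in Linfty -> h \in Linfty -> m (f + h) = m f + m h.
Proof.
case: mean_m => lin _ _ _ fL hL.
by have := lin 1 f h fL hL; rewrite scale1r mul1r.
Qed.

Lemma mean0 : m 0 = 0.
Proof.
have L0 : (0 : borelType G -> R) \in Linfty := Linfty_cst mu 0.
by have := meanD L0 L0; rewrite addr0; lra.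
Qed.

Lemma meanZ a f : f \in Linfty -> m (a *: f) = a * m f.
Proof.
case: mean_m => lin _ _ _ fL; have L0 : (0 : borelType G -> R) \in Linfty := Linfty_cst mu 0.
by have := lin a f 0 fL L0; rewrite mean0 !addr0.
Qed.

Lemma mean_le f h : f \in Linfty -> h \in Linfty -> (forall x, f x <= h x) ->
  m f <= m h.
Proof.
case: mean_m => lin pos _ _ fL hL fh; rewrite -subr_ge0.
have <- : m (-1 *: f + h) = m h - m f by rewrite lin// mulN1r addrC.
apply: pos; first exact: Linfty_lin.
by apply: aeW => x /=; rewrite !fctE/= scaleN1r addrC subr_ge0.
Qed.

Lemma mean_sum (I : Type) (s : seq I) (f : I -> borelType G -> R) :
  (forall i, f i \in Linfty) -> m (\sum_(i <- s) f i) = \sum_(i <- s) m (f i).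
Proof.
move=> fL; elim: s => [|i s IHs]; first by rewrite !big_nil mean0.
by rewrite !big_cons meanD ?IHs//; exact: Linfty_sum.
Qed.

Lemma mean_cst a : m (cst a) = a.
Proof.
case: mean_m => _ _ m1 _; rewrite -[RHS]mulr1 -m1 -meanZ; last exact: Linfty_cst.
congr m.
by apply/funext => x; rewrite !fctE /= /GRing.scale /= mulr1.
Qed.

Lemma mean_shift (g : G) f : f \in Linfty -> m (fun x => f (g * x : G)%g) = m f.
Proof.
by case: mean_m => _ _ _ + fL => /(_ (g^-1)%g f fL); rewrite invgK.
Qed.

End Mean.

(** * Counting lattice points *)

(* A symmetric Delone set L seen through a bounded symmetric open set Q: the
   translates of Q by L cover G with multiplicity at most C. *)
Record window (G : topologicalGroupType) (L Q : set G) (C : nat) : Prop := Window {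
  winV : forall x, L x -> L (x^-1)%g ;
  winQ_open : open Q ;
  winQV : forall z, Q z -> Q (z^-1)%g ;
  win_cover : forall g, exists2 x, L x & Q (g * x)%g ;
  win_count : forall g, exists F : {fset G},
    (#|` F|%fset <= C)%N /\ forall x, L x -> Q (g * x)%g -> x \in F ;
  win_finite : forall e, exists K : {fset G},
    (forall k, k \in K -> L k) /\
    forall k z, L k -> Q (k * z)%g -> Q (z * e)%g -> k \in K }.

Section HitCount.
Variables (R : realType) (G : topologicalGroupType) (L Q : set G) (C : nat).
Hypothesis win : window L Q C.
Variable mu : {measure set (borelType G) -> \bar R}.
Implicit Types (A B D : set G).

(** This is the intersection of A with y^-1 D. For D = Q, the mean of [rhits A Q] is the weight M
    A. *)
Definition hits A D (y : G) : set G := [set x | A x /\ D (y * x)%g].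

Definition nhits A D (y : G) : nat := #|` fset_set (hits A D y)|%fset.

Definition rhits A D (y : borelType G) : R := (nhits A D (y : G))%:R.

Lemma hits_fset A D k y : A `<=` L -> D `<=` [set z | Q (k * z)%g] ->
  exists F : {fset G}, (#|` F|%fset <= C)%N /\ forall x, hits A D y x -> x \in F.
Proof.
move=> AL DQ; have [F [FC FP]] := win_count win (k * y)%g.
exists F; split=> // x [Ax Dx]; apply: FP; first exact: AL.
by rewrite -mulgA; exact: DQ.
Qed.

Lemma nhits_le A D k y : A `<=` L -> D `<=` [set z | Q (k * z)%g] ->
  (nhits A D y <= C)%N.
Proof.
move=> AL DQ; have [F [FC FP]] := hits_fset y AL DQ.
apply: leq_trans FC; apply: fsubset_leq_card; apply/fsubsetP => x.
rewrite in_fset_set ?inE; first exact: FP.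
by apply: sub_finite_set (finite_fset F).
Qed.

(** As D is open, the finitely many hits of y remain hits of all nearby points: the count is lower
    semicontinuous, hence Borel. It is bounded by [C] because D lies in a translate of Q. *)
Lemma rhits_Linfty A D k : A `<=` L -> open D -> D `<=` [set z | Q (k * z)%g] ->
  rhits A D \in Lfun mu +oo%E.
Proof.
move=> AL oD DQ; apply: (@bounded_Lfun _ _ _ _ C%:R) => [|y]; last first.
  by rewrite ger0_norm ?ler0n// ler_nat; exact: nhits_le DQ.
apply: lower_semicontinuous_measurable => a.
rewrite openE => y /= ay.
have [F [_ FP]] := hits_fset y AL DQ.
have fin z : finite_set (hits A D z).
  have [F' [_ F'P]] := hits_fset z AL DQ.
  by apply: sub_finite_set (finite_fset F').
have Dz : \forall z \near y,
    (\bigcap_(x in [set` fset_set (hits A D y)]) [set z | D (z * x)%g]) z.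
  apply: filter_bigI => x; rewrite in_fset_set// inE => -[_ Dx].
  by apply: open_nbhs_nbhs; split=> //; exact: open_mulgr.
apply: filterS Dz => z Dz; apply: lt_le_trans ay _; rewrite ler_nat.
apply: fsubset_leq_card; apply/fsubsetP => x xF; rewrite in_fset_set// inE.
split; last exact: Dz.
by move: xF; rewrite in_fset_set// inE => -[].
Qed.

Lemma rhits_shift A D (g y : G) : rhits A D (g * y)%g = rhits A [set z | D (g * z)%g] y.
Proof.
rewrite /rhits /nhits; congr ((#|` fset_set _ |)%fset%:R).
by apply/seteqP; split=> x [Ax]; split=> //; move: b; rewrite /= mulgA.
Qed.

Variable m : (borelType G -> R) -> R.
Hypothesis mean_m : left_invariant_mean mu m.

Let Q1 : Q `<=` [set z | Q (1 * z)%g].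
Proof. by move=> z; rewrite /= mul1g. Qed.

(* Double counting of pairs (x, k) in A x L: every point of G lies in k^-1 Q for
   some k in L, and in k Q for at most C of them. This is where L = L^-1 enters;
   it replaces unimodularity of G and the uniqueness of Haar measure. *)
Lemma mean_rhits_translate A e :
  A `<=` L -> [set (x * e)%g | x in A] `<=` L ->
  m (rhits [set (x * e)%g | x in A] Q) <= C%:R * m (rhits A Q).
Proof.
set A' := [set _ | _ in A]%classic => AL A'L.
(* A mean is only finitely additive, so the double count must run over finitely many k; [K] contains
   every k in L for which [D k] below is nonempty. *)
have [K [KL KP]] := win_finite win e.
pose D k := [set z | Q (z * e)%g /\ Q (k * z)%g].
have oD k : open (D k).
  by apply: openI; [apply: open_mulgr|apply: open_mulgl]; exact: winQ_open win.
have DQ k : D k `<=` [set z | Q (k * z)%g] by move=> z [].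
have DL k : rhits A (D k) \in Lfun mu +oo%E by apply: rhits_Linfty (DQ k).
have Qo := winQ_open win.
have AQ : rhits A Q \in Lfun mu +oo%E by apply: rhits_Linfty Q1.
have A'Q : rhits A' Q \in Lfun mu +oo%E by apply: rhits_Linfty Q1.
pose h k (y : borelType G) := rhits A (D k) (k^-1 * y : G)%g.
have hL k : h k \in Lfun mu +oo%E.
  rewrite (_ : h k = rhits A [set z | D k (k^-1 * z)%g]).
    (* The shifted set lies in Q, expressed as the set of z with k k^-1 z in Q. *)
    apply: (@rhits_Linfty _ _ (k * k^-1)%g) => //; first exact: open_mulgl.
    by move=> z [_]; rewrite /= mulgA.
  by apply/funext => y; rewrite /h rhits_shift.
(* If y hits a e, some l in L puts l^-1 y a in Q, and then a is a hit of y for [D k] with k = l^-1.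
   Every hit of the translate is thus counted at least once. *)
apply: (@le_trans _ _ (m (\sum_(k <- K) rhits A (D k)))).
  apply: (mean_le mean_m) => //; first exact: Linfty_sum.
  move=> y; rewrite fct_sumE /rhits -natr_sum ler_nat.
  have [F [_ FP]] := hits_fset y A'L Q1.
  have finA' : finite_set (hits A' Q y) by apply: sub_finite_set (finite_fset F).
  pose F' := [fset (x * e^-1)%g | x in fset_set (hits A' Q y)]%fset.
  have -> : nhits A' Q y = #|` F'|%fset.
    by rewrite card_imfset//=; exact: mulIg.
  rewrite (eq_bigr (fun k => \sum_(x <- F') `[< hits A (D k) y x >])%N); last first.
    move=> k _; apply: card_fset_set_sum => x [Ax [Qxe _]].
    apply/imfsetP; exists (x * e)%g; last by rewrite mulgK.
    by rewrite in_fset_set// inE; split; [exists x|rewrite mulgA].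
  rewrite exchange_big /= card_fset_sum1 big_seq [X in (_ <= X)%N]big_seq.
  apply: leq_sum => x /imfsetP[x' /=]; rewrite in_fset_set// inE.
  move=> [[a Aa <-] Qa] ->; rewrite mulgK.
  have [l Ll Ql] := win_cover win ((y * a)^-1)%g.
  have Ql' : Q (l^-1 * (y * a))%g by have := winQV win Ql; rewrite invgM invgK.
  have Qa' : Q (y * a * e)%g by rewrite -mulgA.
  apply: (@sum_bool_ge1 _ _ _ (l^-1)%g).
    by apply: KP Ql' Qa'; exact: winV win _ Ll.
  by split.
(* Left invariance shifts the k-th term by k^-1, which moves its hits into [hits A Q y]. A given x
   is then counted for at most [C] values of k, since k in L must satisfy (y x e)^-1 k in Q. *)
rewrite (mean_sum mean_m)// (eq_bigr (fun k => m (h k))); last first.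
  by move=> k _; rewrite (mean_shift mean_m).
rewrite -(mean_sum mean_m)// -(meanZ mean_m)//.
apply: (mean_le mean_m); first exact: Linfty_sum.
  by rewrite -[_ *: _]addr0; apply: Linfty_lin => //; exact: (Linfty_cst mu 0).
move=> y; rewrite fct_sumE /h /rhits -natr_sum.
rewrite [leRHS](_ : _ = (C * nhits A Q y)%:R); last by rewrite natrM.
rewrite ler_nat.
have [F [_ FP]] := hits_fset y AL Q1.
have finA : finite_set (hits A Q y) by apply: sub_finite_set (finite_fset F).
rewrite (eq_bigr (fun k => \sum_(x <- fset_set (hits A Q y))
    `[< hits A (D k) (k^-1 * (y : G))%g x >])%N); last first.
  move=> k _; apply: card_fset_set_sum => x [Ax [_ Qx]].
  rewrite in_fset_set// inE; split=> //.
  by move: Qx; rewrite !mulgA mulgV mul1g.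
rewrite exchange_big /= /nhits mulnC card_fset_sum1 big_distrl /=.
apply: leq_sum => x _; rewrite mul1n.
have [F' [F'C F'P]] := win_count win ((y * x * e)^-1)%g.
apply: leq_trans F'C; apply: sum_bool_le => k kK [_ [Qk _]].
apply: F'P; first exact: KL.
by have := winQV win Qk; rewrite !invgM invgK !mulgA.
Qed.

End HitCount.

(** * Folner sets from an invariant mean *)

Section FolnerBoundary.
Variables (R : realType) (T : choiceType) (A F : set T) (d : T -> T -> R).
Implicit Types (x y : T) (r : R).

Lemma dist_to_set_lt x (B : set T) r :
  (dist_to_set d x B < r%:E)%E <-> exists2 y, B y & d x y < r.
Proof.
split=> [/ereal_inf_lt[_ [y By <-]]|[y By dxy]].
  by rewrite lte_fin => dxy; exists y.
by apply: le_lt_trans (_ : (d x y)%:E < r%:E)%E => //; apply: ereal_inf_lbound; exists y.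
Qed.

Lemma folner_boundaryP r x :
  folner_boundary A d r F x <->
  [/\ A x, exists2 y, F y & d x y < r & exists2 y, (A `\` F) y & d x y < r].
Proof.
rewrite /folner_boundary /= gt_max.
split=> [[Ax /andP[/dist_to_set_lt ? /dist_to_set_lt ?]]|[Ax xF xAF]] //.
by split=> //; apply/andP; split; exact/dist_to_set_lt.
Qed.

End FolnerBoundary.

Lemma cardfsM (T U : choiceType) (A : {fset T}) (B : {fset U}) :
  #|` A `*` B|%fset = (#|` A| * #|` B|)%N.
Proof.
rewrite card_fset_sum1 big_imfset2 /=; last first.
  by move=> [? ?] [? ?] _ _ /= [-> ->].
rewrite -card_fset_sum1 [X in (X * _)%N]card_fset_sum1 big_distrl /=.
by under [RHS]eq_bigr do rewrite mul1n.
Qed.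

Lemma bernoulli_growth (R : realType) (q M : R) : 0 < q ->
  exists j, M <= (1 + q) ^+ j.
Proof.
move=> q0; have bern j : 1 + j%:R * q <= (1 + q) ^+ j.
  elim: j => [|j IHj]; first by rewrite mul0r addr0 expr0.
  rewrite exprS; apply: (@le_trans _ _ ((1 + q) * (1 + j%:R * q))); last first.
    by rewrite ler_wpM2l//; lra.
  have : 0 <= j%:R * q * q by rewrite !mulr_ge0// ltW.
  by rewrite -natr1; lra.
exists (Num.trunc (M / q)).+1; apply: le_trans (bern _).
have := truncnS_gt (M / q); rewrite ltr_pdivrMr//; lra.
Qed.

Section MeanFolner.
Variables (R : realType) (G : topologicalGroupType) (L Q : set G) (C : nat).
Hypothesis win : window L Q C.
Variable mu : {measure set (borelType G) -> \bar R}.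
Variable m : (borelType G -> R) -> R.
Hypothesis mean_m : left_invariant_mean mu m.

Let Q1 : Q `<=` [set z | Q (1 * z)%g].
Proof. by move=> z; rewrite /= mul1g. Qed.

Let Qo : open Q := winQ_open win.

Let rhitsL A : A `<=` L -> rhits R A Q \in Lfun mu +oo%E.
Proof. by move=> AL; apply: (rhits_Linfty win) AL Qo Q1. Qed.

Let mean_rhits_ge1 : 1 <= m (rhits R L Q).
Proof.
rewrite -(mean_cst mean_m 1); apply: (mean_le mean_m).
- exact: Linfty_cst.
- exact: rhitsL.
- move=> y; rewrite /= /rhits ler1n /nhits cardfs_gt0.
  have [F [_ FP]] := hits_fset win y (fun _ => id) Q1.
  have [x Lx Qx] := win_cover win y; apply/fset0Pn; exists x.
  by rewrite in_fset_set ?inE//; apply: sub_finite_set (finite_fset F).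
Qed.

(* The subsets [B (i, e)] of L on which [a (_, i)] is right translation by e have
   pairwise disjoint translates [A (i, e)], while for each i they partition L. *)
Lemma bounded_multiplicity (N : nat) (E : {fset G}) (a : G * 'I_N -> G) :
  (forall x i, L x -> L (a (x, i)) /\ (x^-1 * a (x, i))%g \in E) ->
  (forall x i y j, L x -> L y -> a (x, i) = a (y, j) -> (x, i) = (y, j)) ->
  (N <= C)%N.
Proof.
move=> aLE a_inj.
pose B (p : 'I_N * G) := [set x | L x /\ a (x, p.1) = (x * p.2)%g].
pose A p := [set (x * p.2)%g | x in B p].
have AL p : A p `<=` L.
  by move=> _ [x [Lx ax] <-]; rewrite -ax; case: (aLE x p.1 Lx).
have BL p : B p `<=` L by move=> x [].
(* Right translation by the inverse of p.2 takes [A p] back to [B p]. *)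
have BA p : m (rhits R (B p) Q) <= C%:R * m (rhits R (A p) Q).
  have BAE : [set (x * p.2^-1)%g | x in A p] = B p.
    apply/seteqP; split=> [_ [_ [x Bx <-] <-]|x Bx]; first by rewrite mulgK.
    by exists (x * p.2)%g; [exists x|rewrite mulgK].
  by have := @mean_rhits_translate _ _ _ _ _ win mu m mean_m (A p) (p.2^-1)%g;
    rewrite BAE; apply.
pose s := [seq (i, e) | i <- enum 'I_N, e <- enum_fset E].
have us : uniq s by rewrite allpairs_uniq ?enum_uniq// => -[? ?] [? ?].
have sumA : \sum_(p <- s) m (rhits R (A p) Q) <= m (rhits R L Q).
  rewrite -(mean_sum mean_m); last by move=> p; exact: rhitsL.
  apply: (mean_le mean_m).
  - by apply: Linfty_sum => p; exact: rhitsL.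
  - exact: rhitsL.
  move=> y; rewrite fct_sumE /rhits -natr_sum ler_nat.
  have [F [_ FP]] := hits_fset win y (fun _ => id) Q1.
  have hitsF p x : hits (A p) Q y x -> x \in F.
    by move=> [/AL Lx Qx]; exact: FP.
  rewrite (eq_bigr _ (fun p _ => card_fset_set_sum (hitsF p))).
  rewrite exchange_big /nhits (card_fset_set_sum FP) /=.
  apply: leq_sum => x _.
  have [[p [Ap Qx]]|nA] := pselect (exists p, hits (A p) Q y x); last first.
    rewrite big1 // => p _; case: asboolP => // Ap.
    by case: nA; exists p.
  have Lx : L x := AL _ _ Ap.
  have -> : `[< hits L Q y x >] by exact/asboolP.
  apply: (@leq_trans (\sum_(q <- s) (q == p))%N); last first.
    apply: (@leq_trans (count_mem p s)); last by rewrite count_uniq_mem// leq_b1.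
    by rewrite -sum1_count [leqRHS]big_mkcond /=; apply: leq_sum => q _; case: eqP.
  apply: leq_sum => q _; case: asboolP => // -[Aq _].
  suff -> : q = p by rewrite eqxx.
  case: Ap Aq => x1 [Lx1 ax1] xE1 [x2 [Lx2 ax2] xE2].
  have := a_inj x1 p.1 x2 q.1 Lx1 Lx2; rewrite ax1 ax2 xE1 xE2 => /(_ erefl)[xE pqE].
  by move: xE1 xE2; rewrite xE => <- /mulgI; case: (p) (q) pqE => [? ?] [? ?] /= -> ->.
have sumB i : m (rhits R L Q) <= \sum_(e <- E) m (rhits R (B (i, e)) Q).
  rewrite -(mean_sum mean_m); last by move=> e; exact: rhitsL.
  apply: (mean_le mean_m).
  - exact: rhitsL.
  - by apply: Linfty_sum => e; exact: rhitsL.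
  move=> y; rewrite fct_sumE /rhits -natr_sum ler_nat.
  have [F [_ FP]] := hits_fset win y (fun _ => id) Q1.
  have hitsF e x : hits (B (i, e)) Q y x -> x \in F.
    by move=> [[Lx _] Qx]; exact: FP.
  rewrite (eq_bigr _ (fun e _ => card_fset_set_sum (hitsF e))).
  rewrite exchange_big /nhits (card_fset_set_sum FP) /=.
  apply: leq_sum => x _; case: asboolP => // -[Lx Qx].
  have [_ xaE] := aLE x i Lx.
  by apply: sum_bool_ge1 xaE _; split=> //; split=> //=; rewrite mulVKg.
(* The chain is N M L <= sum of M (B p) <= C times the sum of M (A p) <= C M L, from [sumB], [BA]
   and [sumA]. *)
have : N%:R * m (rhits R L Q) <= C%:R * m (rhits R L Q).
  apply: (@le_trans _ _ (C%:R * \sum_(p <- s) m (rhits R (A p) Q))); last first.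
    by rewrite ler_wpM2l.
  rewrite mulr_sumr.
  apply: (@le_trans _ _ (\sum_(p <- s) m (rhits R (B p) Q))); last exact: ler_sum.
  rewrite big_allpairs /= big_enum /=.
  rewrite -[N in leLHS]card_ord mulr_natl -sumr_const.
  exact: ler_sum.
by rewrite ler_pM2r ?ler_nat//; exact: lt_le_trans ltr01 _.
Qed.

End MeanFolner.

(** * Uniform expansion in the absence of Folner sets *)

Section Expansion.
Variables (R : realType) (G : topologicalGroupType) (L S : set G).
Variable d : G -> G -> R.
Hypotheses (finS : finite_set S) (genS : generated S = generated L).
Hypothesis QId : quasi_isometry L (word_metric R S) L d id.
Hypothesis metd : is_metric_on L d.

Definition word_nbhd n (x : G) : {fset G} :=
  fset_set [set y | L y /\ word_ball S n (x^-1 * y)%g].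

Lemma finite_word_nbhd n x :
  finite_set [set y | L y /\ word_ball S n (x^-1 * y)%g].
Proof.
have := finite_image (fun g => (x * g)%g) (finite_word_ball n finS).
by apply: sub_finite_set => y [Ly yW]; exists (x^-1 * y)%g => //; rewrite mulVKg.
Qed.

Lemma word_nbhdP n x y :
  reflect (L y /\ word_ball S n (x^-1 * y)%g) (y \in word_nbhd n x).
Proof.
rewrite /word_nbhd in_fset_set; last exact: finite_word_nbhd.
by apply: (iffP idP); rewrite inE.
Qed.

(** Let W be the word ball of radius n, where n bounds the words of displacement at most r, and let
    N be the n-neighbourhood of F. Each point of the r-boundary of F is a point of N outside F times
    an element of W, so the boundary has at most |N \ F| |W| points. As F is not Folner, this is at
    least eps |F|, whence q = eps / |W|. *)
Lemma not_folner_expands : ~ folner_amenable L d ->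
  exists (q : R) n, 0 < q /\ forall F : {fset G}, (forall x, x \in F -> L x) ->
    (1 + q) * #|` F|%fset%:R <= #|` nbhd (word_nbhd n) F|%fset%:R :> R.
Proof.
move=> /existsNP[r /existsNP[eps /existsNP[r0 /existsNP[eps0 nF]]]].
have [n nP] := QI_word_ball genS QId r.
pose W := fset_set (word_ball S n).
have WP g : (g \in W) = `[< word_ball S n g >].
  by rewrite in_fset_set; [rewrite unfold_in|exact: finite_word_ball].
have W0 : (0 < #|` W|%fset)%N.
  rewrite cardfs_gt0; apply/fset0Pn; exists 1%g; rewrite WP; apply/asboolP.
  exact: word_ball1.
exists (eps / #|` W|%fset%:R), n; split; first by rewrite divr_gt0// ltr0n.
move=> F FL; have [->|F0] := eqVneq F fset0.
  by rewrite cardfs0 mulr0 ler0n.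
set N := nbhd _ F; have [d_ge0 d_eq0 d_sym _] := metd.
have FN : (F `<=` N)%fset.
  apply/fsubsetP => x xF; apply/nbhdP; exists x => //; apply/word_nbhdP.
  by split; [exact: FL|rewrite mulVg; exact: word_ball1].
have bndW x : folner_boundary L d r [set` F] x ->
    x \in [fset (y * e)%g | y in (N `\` F)%fset, e in W]%fset.
  move=> /folner_boundaryP[Lx [y yF dxy] [z [Lz zF] dxz]].
  have zx : word_ball S n (x^-1 * z)%g by apply: nP => //; exact: ltW.
  have yx : word_ball S n (y^-1 * x)%g.
    by apply: nP => //; [exact: FL|rewrite d_sym; [exact: ltW|exact: FL|]].
  (* For x in F, the nearby point z of L outside F lies in N; for x outside F, x itself lies in
     N. *)
  apply/imfset2P; have [xF|xF] := boolP (x \in F).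
    exists z; last first.
      exists (z^-1 * x)%g; last by rewrite mulVKg.
      by rewrite /= WP; apply/asboolP; rewrite -(invgK x) -invgM; exact: word_ballV.
    rewrite /= in_fsetD; apply/andP; split; first exact/negP.
    by apply/nbhdP; exists x => //; apply/word_nbhdP.
  exists x; last first.
    by exists 1%g; rewrite ?mulg1//= WP; apply/asboolP; exact: word_ball1.
  rewrite /= in_fsetD xF; apply/nbhdP; exists y => //.
  exact/word_nbhdP.
have finbnd : finite_set (folner_boundary L d r [set` F]).
  apply: sub_finite_set (finite_fset
    [fset (y * e)%g | y in (N `\` F)%fset, e in W]%fset) => x.
  exact: bndW.
have card_bnd : (#|` fset_set (folner_boundary L d r [set` F])|%fset
    <= (#|` N|%fset - #|` F|%fset) * #|` W|%fset)%N.
  rewrite -cardfsDS// -cardfsM.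
  apply: leq_trans (_ : #|` [fset (p.1 * p.2)%g | p in ((N `\` F) `*` W)%fset]|%fset <= _)%N.
    apply: fsubset_leq_card; apply/fsubsetP => x; rewrite in_fset_set// inE.
    move=> /bndW/imfset2P[y /= yN [e /= eW ->]].
    by apply/imfsetP; exists (y, e) => //=; rewrite in_fsetM yN eW.
  exact: leq_imfset_card.
have leN : eps * #|` F|%fset%:R <=
    #|` fset_set (folner_boundary L d r [set` F])|%fset%:R.
  have F_gt0 : 0 < #|` F|%fset%:R :> R by rewrite ltr0n cardfs_gt0.
  rewrite -ler_pdivlMr// leNgt; apply/negP => ltN; apply: nF; exists [set` F].
  split=> //; last by rewrite set_fsetK.
  by have /fset0Pn[x xF] := F0; exists x.
have WR : 0 < #|` W|%fset%:R :> R by rewrite ltr0n.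
rewrite mulrDl mul1r -lerBrDl mulrAC ler_pdivrMr//.
apply: le_trans leN _; rewrite -natrB ?fsubset_leq_card// -natrM ler_nat.
exact: card_bnd.
Qed.

(** Neighbourhoods stay inside L, so the expansion applies to them again: factors multiply while
    radii add. *)
Lemma nbhd_iterate (q : R) n : 0 < q ->
  (forall F : {fset G}, (forall x, x \in F -> L x) ->
    (1 + q) * #|` F|%fset%:R <= #|` nbhd (word_nbhd n) F|%fset%:R) ->
  forall j (F : {fset G}), (forall x, x \in F -> L x) ->
    (1 + q) ^+ j * #|` F|%fset%:R <= #|` nbhd (word_nbhd (j * n)) F|%fset%:R.
Proof.
move=> q0 expF; elim=> [|j IHj] F FL.
  rewrite expr0 mul1r ler_nat; apply: fsubset_leq_card; apply/fsubsetP => x xF.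
  apply/nbhdP; exists x => //; apply/word_nbhdP.
  by split; [exact: FL|rewrite mulVg; exact: word_ball1].
set N := nbhd (word_nbhd (j * n)) F.
have NL x : x \in N -> L x by move=> /nbhdP[y _ /word_nbhdP[]].
apply: (@le_trans _ _ #|` nbhd (word_nbhd n) N|%fset%:R).
  apply: le_trans (expF _ NL); rewrite exprS -mulrA ler_wpM2l//; first lra.
  exact: IHj.
rewrite ler_nat; apply: fsubset_leq_card; apply/fsubsetP => z.
move=> /nbhdP[y /nbhdP[x xF /word_nbhdP[Ly xy]] /word_nbhdP[Lz yz]].
apply/nbhdP; exists x => //; apply/word_nbhdP; split=> //.
rewrite mulSn addnC -[(x^-1 * z)%g](_ : x^-1 * y * (y^-1 * z) = _)%g.
  exact: word_ballM.
by rewrite -mulgA mulVKg.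
Qed.

(** Without Folner sets, neighbourhoods of a large radius j n expand by at least N = C + 1. Hall's
    theorem on N copies of L then yields an injection into L of bounded displacement, which
    contradicts [bounded_multiplicity]. *)
Theorem folner_amenable_of_mean (Q : set G) (C : nat)
    (mu : {measure set (borelType G) -> \bar R}) (m : (borelType G -> R) -> R) :
  window L Q C -> left_invariant_mean mu m -> folner_amenable L d.
Proof.
move=> win mean_m; apply: contrapT => /not_folner_expands[q [n [q0 expF]]].
have [j Cj] := bernoulli_growth C.+1%:R q0.
pose N := C.+1; pose nb (p : G * 'I_N) := word_nbhd (j * n) p.1.
pose I : {fset 'I_N} := [fset i in 'I_N]%fset.
have cI : #|` I|%fset = N by rewrite card_imfset//= -cardE card_ord.
pose V k : {fset G} := fset_set [set y | L y /\ word_ball S k y].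
have VP k y : (y \in V k) <-> L y /\ word_ball S k y.
  have fin : finite_set [set y | L y /\ word_ball S k y].
    by apply: sub_finite_set (finite_word_ball k finS) => z [].
  by rewrite in_fset_set// inE.
have [||B BL|a [a_nb a_inj]] := @hall_exhausted _ _ (1%g : G) nb
    [set p | L p.1] (fun k => (V k `*` I)%fset).
- by move=> k [x i]; rewrite in_fsetM => /andP[/VP[]].
- move=> [x i] /= Lx; have : generated S x by rewrite genS; exact: generated_sub.
  move=> /generated_word[k xk]; exists k => // l /= kl.
  rewrite in_fsetM /=; apply/andP; split; last by rewrite in_fset inE.
  by apply/VP; split=> //; exists k.
(* [B] lies over its projection [F] with at most N points in each fibre, and has the same neighbours
   as [F]. *)
- pose F := [fset p.1 | p in B]%fset.
  have FL x : x \in F -> L x by move=> /imfsetP[p /= /BL Lp ->].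
  have leB : (#|` B|%fset <= N * #|` F|%fset)%N.
    apply: leq_trans (_ : #|` F `*` I|%fset <= _)%N.
      apply: fsubset_leq_card; apply/fsubsetP => -[x i] xiB.
      rewrite in_fsetM /= in_fset inE andbT; apply/imfsetP.
      by exists (x, i).
    by rewrite cardfsM cI mulnC.
  apply: leq_trans leB _; rewrite -(ler_nat R) natrM.
  apply: (@le_trans _ _ #|` nbhd (word_nbhd (j * n)) F|%fset%:R); last first.
    rewrite ler_nat; apply: fsubset_leq_card; apply/fsubsetP => y.
    move=> /nbhdP[_ /imfsetP[p /= pB ->] yp]; apply/nbhdP; exists p => //.
  apply: le_trans (nbhd_iterate q0 expF j FL).
  by rewrite ler_wpM2r.
suff : (N <= C)%N by rewrite ltnn.
apply: (@bounded_multiplicity _ _ _ _ _ win mu m mean_m N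
  (fset_set (word_ball S (j * n))) a) => [x i Lx|x i y k Lx Ly]; last exact: a_inj.
have /word_nbhdP[La Wa] := a_nb (x, i) Lx; split=> //.
by rewrite in_fset_set ?inE//; exact: finite_word_ball.
Qed.

End Expansion.

(** * Haar measure *)

Definition lmulset (G : groupType) (g : G) (A : set G) : set G :=
  [set (g * x)%g | x in A].

Lemma lmulsetE (G : groupType) (g : G) (A : set G) :
  lmulset g A = [set x | A (g^-1 * x)%g].
Proof.
apply/seteqP; split=> [_ [x Ax <-]|x Ax]; first by rewrite /= mulKg.
by exists (g^-1 * x)%g => //; rewrite mulVKg.
Qed.

Lemma lmulsetK (G : groupType) (g : G) (A : set G) :
  lmulset (g^-1)%g (lmulset g A) = A.
Proof.
rewrite !lmulsetE; apply/seteqP; split=> x /=; by rewrite invgK mulKg.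
Qed.

(** * Covering numbers of compact sets by small balls *)

Section CoveringNumbers.
Variables (R : realType) (G : topologicalGroupType) (d : G -> G -> R).
Hypothesis admd : admissible_metric d.
Hypothesis hausG : hausdorff_space G.
Implicit Types (K A V W : set G) (n : nat) (s : seq G) (x y : G).

(** Around each point of K choose a radius whose double still fits in some [O i]; the least radius
    of a finite subcover is a Lebesgue number. *)
Lemma lebesgue_number (I : Type) (O : I -> set G) K : compact K ->
  (forall x, K x -> exists i, exists2 r, 0 < r & forall y, d x y < r -> O i y) ->
  exists2 delta, 0 < delta &
    forall x, K x -> exists i, forall y, d x y < delta -> O i y.
Proof.
move=> cK KO.
have /choice[f fP] x : exists r : R, 0 < r /\ (K x -> exists i,
    forall y, d x y < r + r -> O i y).
  have [Kx|Kx] := pselect (K x); last by exists 1; split.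
  have [i [r r0 rO]] := KO x Kx; exists (r / 2).
  by split=> [|_]; [rewrite divr_gt0|exists i => y; rewrite -splitr; exact: rO].
have [|x Kx|F FK Fcov] := group_compact_cover cK (D := K)
    (f := fun x => [set y | d x y < f x]).
- by move=> x _; exact: open_adm_ball.
- by exists x => //=; rewrite (admxx admd); case: (fP x).
have [delta delta0 deltaF] : exists2 delta : R, 0 < delta &
    forall x, x \in enum_fset F -> delta <= f x.
  elim: (enum_fset F) => [|x s [e e0 es]]; first by exists 1; rewrite ?ltr01.
  exists (Order.min (f x) e).
    by rewrite lt_min e0 andbT; case: (fP x).
  move=> y; rewrite inE => /orP[/eqP ->|/es es']; first by rewrite ge_min lexx.
  by rewrite ge_min es' orbT.
exists delta => // x /Fcov[c /= cF cx]; have Kc : K c.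
  by have := FK c cF; rewrite inE.
have [_ /(_ Kc)[i iO]] := fP c; exists i => y xy; apply: iO.
apply: le_lt_trans (adm_triangle admd x _ _) _.
by rewrite ltrD// (lt_le_trans xy)// deltaF.
Qed.

Lemma compact_disjoint_separated K K' : compact K -> compact K' ->
  K `&` K' = set0 -> exists2 delta, 0 < delta &
    forall x y, K x -> K' y -> delta <= d x y.
Proof.
move=> cK cK' KK'.
have oK' : open (~` K') by apply: closed_openC; exact: compact_closed.
have [x Kx|delta delta0 deltaP] := lebesgue_number (O := fun _ : unit => ~` K') cK.
  exists tt; apply: (open_admP admd oK') => K'x.
  by have : (K `&` K') x by []; rewrite KK'.
exists delta => // x y Kx K'y; rewrite leNgt; apply/negP => dxy.
by have [_ /(_ y dxy)] := deltaP x Kx.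
Qed.

(** With delta a Lebesgue number of the cover, keep for each of V and W the points of K whose
    delta-ball it contains. These two sets are closed in K and together exhaust it. *)
Lemma compact_split K V W : compact K -> open V -> open W -> K `<=` V `|` W ->
  exists K1 K2, [/\ compact K1, compact K2, K1 `<=` V, K2 `<=` W & K `<=` K1 `|` K2].
Proof.
move=> cK oV oW KVW.
have [x Kx|delta delta0 deltaP] := lebesgue_number
    (O := fun b : bool => if b then V else W) cK.
  by case: (KVW x Kx) => [Vx|Wx]; [exists true|exists false]; exact: (open_admP admd).
pose core A := K `&` [set x | forall y, d x y < delta -> A y].
have compact_core A : compact (core A).
  apply: (subclosed_compact _ cK); last by move=> x [].
  apply: closedI; first exact: compact_closed.
  rewrite -openC; apply: (open_adm admd) => x /existsNP[y /not_implyP[xy Ay]].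
  exists (delta - d x y); first by rewrite subr_gt0.
  move=> z xz /(_ y) /= h; apply: Ay; apply: h.
  by have := adm_triangle admd x z y; rewrite (adm_sym admd z x); lra.
have core_sub A : core A `<=` A.
  by move=> x [_]; apply; rewrite (admxx admd).
exists (core V), (core W); split=> // x Kx.
by have [[] P] := deltaP x Kx; [left|right].
Qed.

Definition ball_cover n s K :=
  forall x, K x -> exists2 c, c \in s & d c x < n.+1%:R^-1.

(* 0 when no finite cover exists, which does not happen for compact [K]. *)
Definition covnum n K : nat :=
  if pselect (exists k, `[< exists2 s, size s = k & ball_cover n s K >])
  is left ex then ex_minn ex else 0.

Lemma covnum_le n s K : ball_cover n s K -> (covnum n K <= size s)%N.
Proof.
move=> sK; rewrite /covnum; case: pselect => // ex.
by case: ex_minnP => k _; apply; apply/asboolP; exists s.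
Qed.

Lemma covnum_cover n K : compact K ->
  exists2 s, size s = covnum n K & ball_cover n s K.
Proof.
move=> cK; rewrite /covnum; case: pselect => [ex|[]].
  by case: ex_minnP => k /asboolP[s sk sK] _; exists s.
have [|x Kx|F _ Fcov] := group_compact_cover cK (D := setT)
    (f := fun x => [set y | d x y < n.+1%:R^-1]).
- by move=> x _; exact: open_adm_ball.
- by exists x => //=; rewrite (admxx admd) invr_gt0 ltr0n.
exists (size (enum_fset F)); apply/asboolP.
by exists (enum_fset F).
Qed.

Lemma covnum_sub n K K' : compact K' -> K `<=` K' -> (covnum n K <= covnum n K')%N.
Proof.
move=> /(covnum_cover n)[s <- sK'] KK'; apply: covnum_le => x /KK'; exact: sK'.
Qed.

Lemma covnumU n K K' : compact K -> compact K' ->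
  (covnum n (K `|` K') <= covnum n K + covnum n K')%N.
Proof.
move=> /(covnum_cover n)[s <- sK] /(covnum_cover n)[t <- tK'].
rewrite -size_cat; apply: covnum_le => x [/sK|/tK'][c cs cx]; exists c => //;
  by rewrite mem_cat cs ?orbT.
Qed.

Lemma compact_lmulset (g : G) K : compact K -> compact (lmulset g K).
Proof.
move=> cK; apply: continuous_compact => //.
by apply: continuous_subspaceT; exact: mulg_continuous_l.
Qed.

Lemma covnum_lmulset n (g : G) K : compact K ->
  covnum n (lmulset g K) = covnum n K.
Proof.
have le h A : compact A -> (covnum n (lmulset h A) <= covnum n A)%N.
  move=> /(covnum_cover n)[s <- sA]; rewrite -(size_map (fun x => (h * x)%g)).
  apply: covnum_le => _ [x /sA[c cs cx] <-]; exists (h * c)%g; first exact: map_f.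
  by rewrite (admMl admd).
move=> cK; apply/eqP; rewrite eqn_leq le//= -{1}(lmulsetK g K).
by apply: le; exact: compact_lmulset.
Qed.

(** By the triangle inequality no covering ball meets both sets, so an optimal cover of the union
    splits into disjoint covers of the two. *)
Lemma covnum_separated n K K' : compact K -> compact K' ->
  (forall x y, K x -> K' y -> n.+1%:R^-1 + n.+1%:R^-1 <= d x y) ->
  (covnum n K + covnum n K' <= covnum n (K `|` K'))%N.
Proof.
move=> cK cK' sepKK'.
have [s <- sKK'] := covnum_cover n (compactU cK cK').
pose near_K A c := `[< exists2 x, A x & d c x < n.+1%:R^-1 >].
have cov A : A `<=` K `|` K' -> (covnum n A <= count (near_K A) s)%N.
  move=> AKK'; rewrite -size_filter; apply: covnum_le => x Ax.
  have [c cs cx] := sKK' x (AKK' x Ax); exists c => //.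
  by rewrite mem_filter cs andbT; apply/asboolP; exists x.
apply: (@leq_trans (count (near_K K) s + count (near_K K') s)).
  by apply: leq_add; apply: cov => x ?; [left|right].
rewrite -count_predUI [X in (_ + X)%N](_ : _ = 0%N) ?addn0 ?count_size//.
apply/eqP; rewrite -leqn0 leqNgt -has_count; apply/hasPn => c _ /=.
apply/negP => /andP[/asboolP[x Kx cx] /asboolP[y Ky cy]].
have := sepKK' x y Kx Ky; rewrite leNgt => /negP; apply.
apply: le_lt_trans (adm_triangle admd c x y) _.
by rewrite (adm_sym admd x c) ltrD.
Qed.

End CoveringNumbers.

(** * From Haar's covering ratios to an invariant Borel measure *)

Section Content.
Variables (R : realType) (G : topologicalGroupType) (d : G -> G -> R).
Hypothesis admd : admissible_metric d.
Hypothesis hausG : hausdorff_space G.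
Implicit Types (K A V W : set G) (n : nat) (s : seq G) (x y : G).

Let unit_ball : set G := [set y | d 1%g y <= 1].

Let compact_unit_ball : compact unit_ball.
Proof. exact: (compact_adm_ball admd). Qed.

Definition covratio K n : R := (covnum d n K)%:R / (covnum d n unit_ball)%:R.

(** Covering ratios are subadditive at every scale, but additive on disjoint compact sets only at
    scales below their separation; the limit makes this additivity exact. *)
Definition content K : R := ulim (covratio K).

Lemma covnum_unit_gt0 n : (0 < covnum d n unit_ball)%N.
Proof.
have [s <- sB] := covnum_cover admd n compact_unit_ball.
have [|c cs _] := sB 1%g; first by rewrite /unit_ball /= (admxx admd).
by case: s cs sB.
Qed.

Lemma covratio_ge0 K n : 0 <= covratio K n.
Proof. by rewrite /covratio divr_ge0. Qed.

(** K is covered by finitely many translates of the unit ball, and covering numbers are left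
    invariant; the number of translates bounds the ratio at every scale. *)
Lemma covratio_bounded K : compact K -> useq_bounded (covratio K).
Proof.
move=> cK; have [|x Kx|F _ Fcov] := group_compact_cover cK (D := setT)
    (f := fun x => [set y | d x y < 1]).
- by move=> x _; exact: open_adm_ball.
- by exists x => //=; rewrite (admxx admd).
exists (size (enum_fset F))%:R => n; rewrite ger0_norm ?covratio_ge0//.
rewrite /covratio ler_pdivrMr ?ltr0n ?covnum_unit_gt0//.
have [s <- sB] := covnum_cover admd n compact_unit_ball.
rewrite -natrM ler_nat -(size_allpairs (fun x y => (x * y)%g)).
apply: covnum_le => x /Fcov[c /= cF cx].
have [|b bs bx] := sB (c^-1 * x)%g.
  by rewrite /unit_ball /= -(admMl admd c) mulg1 mulVKg ltW.
exists (c * b)%g; first exact: allpairs_f.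
by rewrite -(mulVKg c x) (admMl admd).
Qed.

Lemma content_sub K K' : compact K -> compact K' -> K `<=` K' ->
  content K <= content K'.
Proof.
move=> cK cK' KK'; apply: ulim_le; try exact: covratio_bounded.
apply: nearW => n; rewrite ler_wpM2r ?invr_ge0// ler_nat.
exact: covnum_sub.
Qed.

Lemma contentU K K' : compact K -> compact K' ->
  content (K `|` K') <= content K + content K'.
Proof.
move=> cK cK'; rewrite -ulimD; try exact: covratio_bounded.
apply: ulim_le; [exact/covratio_bounded/compactU|
  by apply: useq_boundedD; exact: covratio_bounded|].
apply: nearW => n; rewrite -mulrDl ler_wpM2r ?invr_ge0// -natrD ler_nat.
exact: covnumU.
Qed.

Lemma content_disjoint K K' : compact K -> compact K' -> K `&` K' = set0 ->
  content K + content K' <= content (K `|` K').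
Proof.
move=> cK cK' KK'.
have [delta delta0 sep] := compact_disjoint_separated admd hausG cK cK' KK'.
rewrite -ulimD; try exact: covratio_bounded.
apply: ulim_le; [by apply: useq_boundedD; exact: covratio_bounded|
  exact/covratio_bounded/compactU|].
have delta2 : 0 < delta / 2 by rewrite divr_gt0.
near=> n; rewrite -mulrDl ler_wpM2r ?invr_ge0// -natrD ler_nat.
apply: covnum_separated => // x y Kx K'y; apply: le_trans (sep x y Kx K'y).
rewrite [leRHS]splitr lerD// ltW//; near: n; exact: near_infty_natSinv_lt (PosNum delta2).
Unshelve. all: by end_near. Qed.

Lemma content_lmulset (g : G) K : compact K -> content (lmulset g K) = content K.
Proof.
move=> cK; congr ulim; apply/funext => n.
by rewrite /covratio covnum_lmulset.
Qed.

Lemma content_unit_ball : content unit_ball = 1.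
Proof.
rewrite -[RHS]ulim_cst; congr ulim; apply/funext => n.
by rewrite /covratio divff// pnatr_eq0 -lt0n covnum_unit_gt0.
Qed.

Lemma content0 : content set0 = 0.
Proof.
rewrite -[RHS]ulim_cst; congr ulim; apply/funext => n.
rewrite /covratio [covnum d n set0](_ : _ = 0%N) ?mul0r//.
by apply/eqP; rewrite -leqn0; apply: (@covnum_le _ _ _ n [::]).
Qed.

Local Open Scope ereal_scope.

Definition inner_content V : \bar R :=
  ereal_sup [set (content K)%:E | K in [set K | compact K /\ K `<=` V]].

Lemma inner_content_ub V K : compact K -> K `<=` V ->
  (content K)%:E <= inner_content V.
Proof. by move=> cK KV; apply: ereal_sup_ubound; exists K. Qed.

Lemma inner_content_le V (a : \bar R) :
  (forall K, compact K -> K `<=` V -> (content K)%:E <= a) -> inner_content V <= a.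
Proof. by move=> h; apply: ge_ereal_sup => _ [K [cK KV] <-]; exact: h. Qed.

Lemma inner_content_ge0 V : 0 <= inner_content V.
Proof.
apply: (@le_trans _ _ (content set0)%:E); first by rewrite content0.
by apply: inner_content_ub => //; exact: compact0.
Qed.

Lemma inner_content_sub V W : V `<=` W -> inner_content V <= inner_content W.
Proof.
move=> VW; apply: inner_content_le => K cK KV; apply: inner_content_ub => //.
exact: subset_trans VW.
Qed.

Lemma inner_content0 : inner_content set0 = 0.
Proof.
apply/eqP; rewrite eq_le inner_content_ge0 andbT.
by apply: inner_content_le => K _; rewrite subset0 => ->; rewrite content0.
Qed.

Lemma inner_contentU V W : open V -> open W ->
  inner_content (V `|` W) <= inner_content V + inner_content W.
Proof.
move=> oV oW; apply: inner_content_le => K cK KVW.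
have [K1 [K2 [cK1 cK2 K1V K2W KK]]] := compact_split admd hausG cK oV oW KVW.
apply: (@le_trans _ _ ((content K1)%:E + (content K2)%:E)).
  rewrite -EFinD lee_fin; apply: le_trans (contentU cK1 cK2).
  by apply: content_sub => //; exact: compactU.
by apply: leeD; exact: inner_content_ub.
Qed.

(** A compact subset of the union lies in finitely many [V i], where the binary inequality can be
    iterated. *)
Lemma inner_content_bigcup (V : nat -> set G) : (forall i, open (V i)) ->
  inner_content (\bigcup_i V i) <= \sum_(i <oo) inner_content (V i).
Proof.
move=> oV; have finV n : inner_content (\big[setU/set0]_(i < n) V i) <=
    \sum_(0 <= i < n) inner_content (V i).
  elim: n => [|n IHn]; first by rewrite big_ord0 big_geq// inner_content0.
  rewrite big_ord_recr big_nat_recr//=.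
  apply: le_trans (leeD2r _ IHn); apply: inner_contentU => //.
  by rewrite -bigcup_mkord; apply: bigcup_open => i _; exact: oV.
apply: inner_content_le => K cK KV.
have [//|//|F _ Fcov] := group_compact_cover cK (D := setT) (f := V).
pose n := (\max_(i <- enum_fset F) i).+1.
apply: (@le_trans _ _ (inner_content (\big[setU/set0]_(i < n) V i))).
  apply: inner_content_ub => // x /Fcov[i /= iF Vx].
  rewrite -bigcup_mkord; exists i => //=.
  by rewrite ltnS; exact: leq_bigmax_seq.
apply: le_trans (finV n) _; apply: nneseries_lim_ge => i _ _.
exact: inner_content_ge0.
Qed.

Lemma inner_content_lmulset (g : G) V :
  inner_content (lmulset g V) = inner_content V.
Proof.
have le h W : inner_content (lmulset h W) <= inner_content W.
  apply: inner_content_le => K cK KW.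
  rewrite -(content_lmulset (h^-1)%g cK); apply: inner_content_ub.
    exact: compact_lmulset.
  by move=> _ [x /KW[y Wy <-] <-]; rewrite mulKg.
by apply/eqP; rewrite eq_le le/= -{1}(lmulsetK g V) le.
Qed.

Definition haar_outer (A : set (pointed_group G)) : \bar R :=
  ereal_inf [set inner_content V | V in [set V : set G | open V /\ A `<=` V]].

Lemma haar_outer_lb A V : open V -> A `<=` V -> haar_outer A <= inner_content V.
Proof. by move=> oV AV; apply: ereal_inf_lbound; exists V. Qed.

Lemma haar_outer_ge A (a : \bar R) :
  (forall V, open V -> A `<=` V -> a <= inner_content V) -> a <= haar_outer A.
Proof. by move=> h; apply: le_ereal_inf_tmp => _ [V [oV AV] <-]; exact: h. Qed.

Lemma haar_outer_open V : open V -> haar_outer V = inner_content V.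
Proof.
move=> oV; apply/eqP; rewrite eq_le haar_outer_lb//=.
by apply: haar_outer_ge => W _; exact: inner_content_sub.
Qed.

Lemma haar_outer0 : haar_outer set0 = 0.
Proof. by rewrite haar_outer_open ?inner_content0//; exact: open0. Qed.

Lemma haar_outer_ge0 A : 0 <= haar_outer A.
Proof. by apply: haar_outer_ge => V _ _; exact: inner_content_ge0. Qed.

Lemma haar_outer_sub A B : A `<=` B -> haar_outer A <= haar_outer B.
Proof.
move=> AB; apply: haar_outer_ge => V oV BV; apply: haar_outer_lb => //.
exact: subset_trans BV.
Qed.

Lemma haar_outer_sigma_subadditive : sigma_subadditive haar_outer.
Proof.
move=> A; have [[i ioo]|] := pselect (exists i, haar_outer (A i) = +oo).
  rewrite (eseries_pinfty _ _ ioo) ?leey// => n _.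
  by rewrite -ltNye (lt_le_trans _ (haar_outer_ge0 _)).
rewrite -forallNE => Aoo; apply/lee_addgt0Pr => e e0.
rewrite (le_trans _ (epsilon_trick _ _ _))//; last exact: ltW; last first.
  by move=> n; exact: haar_outer_ge0.
have /choice[V VP] n : exists V : set G, [/\ open V, A n `<=` V &
    inner_content V <= haar_outer (A n) + (e / (2 ^ n.+1)%:R)%:E].
  have en0 : (0 < e / (2 ^ n.+1)%:R)%R by rewrite divr_gt0// ltr0n expn_gt0.
  have fin : haar_outer (A n) \is a fin_num.
    by rewrite ge0_fin_numE ?haar_outer_ge0// ltey; apply/eqP; exact: Aoo.
  have [_ [W [oW AW] <-] /ltW leW] := lb_ereal_inf_adherent en0 fin.
  by exists W.
apply: (@le_trans _ _ (inner_content (\bigcup_n V n))).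
  apply: haar_outer_lb; first by apply: bigcup_open => n _; case: (VP n).
  by apply: subset_bigcup => n _; case: (VP n).
apply: le_trans (inner_content_bigcup _) _; first by move=> i; case: (VP i).
apply: lee_nneseries => n _; first by move=> _; exact: inner_content_ge0.
by case: (VP n).
Qed.

(** Replace X by an open V containing it. Exhaust V inside U by a compact K, then V minus K, which
    is open and contains V minus U, by a compact K'. These are disjoint compact subsets of V, so
    their contents add up to at most that of V. *)
Lemma haar_outer_split (U : set G) (X : set (pointed_group G)) : open U ->
  haar_outer (X `&` U) + haar_outer (X `&` ~` U) <= haar_outer X.
Proof.
move=> oU; apply: haar_outer_ge => V oV XV.
have [->|Voo] := eqVneq (inner_content V) +oo; first exact: leey.
have Vfin : inner_content V \is a fin_num.
  by rewrite ge0_fin_numE ?inner_content_ge0// ltey.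
have VU : haar_outer (X `&` U) <= inner_content (V `&` U).
  by apply: haar_outer_lb; [exact: openI|exact: setSI].
have VUC : haar_outer (X `&` ~` U) <= haar_outer (V `&` ~` U).
  by apply: haar_outer_sub; exact: setSI.
apply: le_trans (leeD VU VUC) _.
(* Finiteness allows terms to be moved across inequalities of extended reals. *)
have fin : haar_outer (V `&` ~` U) \is a fin_num.
  rewrite ge0_fin_numE ?haar_outer_ge0//; apply: le_lt_trans (_ : inner_content V < +oo).
    by apply: haar_outer_lb => // x [].
  by rewrite ltey.
rewrite -leeBrDr//; apply: inner_content_le => K cK KVU.
rewrite leeBrDr// addeC -leeBrDr//.
have oVK : open (V `&` ~` K).
  by apply: openI => //; apply: closed_openC; exact: compact_closed.
apply: (@le_trans _ _ (inner_content (V `&` ~` K))).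
  by apply: haar_outer_lb => // x [Vx Ux]; split=> // /KVU[].
apply: inner_content_le => K' cK' K'V.
rewrite leeBrDr// -EFinD; apply: le_trans (_ : (content (K' `|` K))%:E <= _).
  rewrite lee_fin; apply: content_disjoint => //.
  by rewrite -subset0 => x [/K'V[_ Kx]].
apply: inner_content_ub; first exact: compactU.
by move=> x [/K'V[]|/KVU[]].
Qed.

Lemma haar_outer_lmulset (g : G) A : haar_outer (lmulset g A) = haar_outer A.
Proof.
have le h B : haar_outer (lmulset h B) <= haar_outer B.
  apply: haar_outer_ge => V oV BV; rewrite -(inner_content_lmulset h V).
  apply: haar_outer_lb; last by apply: image_subset.
  by rewrite lmulsetE; exact: open_mulgl.
by apply/eqP; rewrite eq_le le/= -{1}(lmulsetK g A) le.
Qed.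

Lemma haar_outer_compact K : compact K -> haar_outer K < +oo.
Proof.
move=> /(compact_bounded admd)[r Kr].
apply: le_lt_trans (haar_outer_lb (open_dball admd r) Kr) _.
apply: le_lt_trans (ltry (content [set y | (d 1%g y <= r)%R])).
apply: inner_content_le => K' cK' K'r; rewrite lee_fin; apply: content_sub => //.
  exact: (compact_adm_ball admd).
by move=> x /K'r; exact: ltW.
Qed.

Lemma haar_outer_setT : 1 <= haar_outer setT.
Proof.
rewrite haar_outer_open; last exact: openT.
apply: (@le_trans _ _ (content unit_ball)%:E); first by rewrite content_unit_ball.
exact: inner_content_ub.
Qed.

Theorem left_haar_measure_exists :
  exists mu : {measure set (borelType G) -> \bar R}, left_haar_measure mu.
Proof.
pose om : {outer_measure set (pointed_group G) -> \bar R} := HB.pack haar_outer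
  (isOuterMeasure.Build R (pointed_group G) haar_outer haar_outer0
    haar_outer_ge0 haar_outer_sub haar_outer_sigma_subadditive).
(* Caratheodory-measurable sets form a sigma-algebra, and [haar_outer_split] puts the open sets in
   it. *)
have borel_cara (A : set (borelType G)) : measurable A ->
    @measurable _ (caratheodory_type om) A.
  apply: smallest_sub; first exact: (@sigma_algebra_measurable _ (caratheodory_type om)).
  by move=> U oU; apply: le_caratheodory_measurable => X; exact: haar_outer_split.
pose haar (A : set (borelType G)) : \bar R := haar_outer A.
have haar_sigma : semi_sigma_additive haar.
  move=> F mF tF mUF.
  apply: (@caratheodory_measure_sigma_additive R (pointed_group G) om) => //.
    by move=> i; exact: borel_cara.
  exact: borel_cara.
pose mu : {measure set (borelType G) -> \bar R} := HB.pack haar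
  (isMeasure.Build _ _ _ haar haar_outer0 haar_outer_ge0 haar_sigma).
exists mu; split.
- by apply: lt_le_trans haar_outer_setT; rewrite lte01.
- exact: haar_outer_compact.
- by move=> g A mA; exact: haar_outer_lmulset.
Qed.

End Content.

(** * An invariant mean from Folner sets *)

Section FiniteCovers.
Local Open Scope ereal_scope.
Context disp (T : measurableType disp) (R : realType).
Variable mu : {measure set T -> \bar R}.

Lemma measure_cover_le (I : eqType) (s : seq I) (F : I -> set T) (A : set T) :
  measurable A -> (forall i, measurable (F i)) ->
  (forall x, A x -> exists2 i, i \in s & F i x) ->
  mu A <= \sum_(i <- s) mu (F i).
Proof.
move=> + mF; elim: s A => [|i s IHs] A mA AF.
  rewrite big_nil (_ : A = set0) ?measure0//.
  by rewrite -subset0 => x /AF[].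
rewrite big_cons; apply: (@le_trans _ _ (mu (F i `|` A `\` F i))).
  apply: le_measure; rewrite ?inE//.
    by apply: measurableU => //; exact: measurableD.
  by move=> x Ax; have [?|?] := pselect (F i x); [left|right].
apply: le_trans (measureU2 _ _ _) _ => //; first exact: measurableD.
apply: leeD2l; apply: IHs; first exact: measurableD.
by move=> x [/AF[j]]; rewrite inE => /orP[/eqP -> //|js Fj _]; exists j.
Qed.

(** Integrate over A the sum of the indicators, which is at most C everywhere. *)
Lemma measure_multiplicity_le (I : Type) (s : seq I) (F : I -> set T) (A : set T) (C : nat) :
  measurable A -> (forall i, measurable (F i)) -> (forall i, F i `<=` A) ->
  (forall x, (\sum_(i <- s) `[< F i x >] <= C)%N) ->
  \sum_(i <- s) mu (F i) <= C%:R%:E * mu A.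
Proof.
move=> mA mF FA FC; rewrite -(integral_cst mu mA).
rewrite (eq_bigr (fun i => \int[mu]_(x in A) (\1_(F i) x)%:E)); last first.
  by move=> i _; rewrite integral_indic// setIidl//; exact: FA.
rewrite -ge0_integral_sum//.
- apply: ge0_le_integral => //.
  + by move=> x _; apply: sume_ge0 => i _; rewrite lee_fin.
  + by apply: emeasurable_sum => i; apply/measurable_EFinP; exact: measurable_indic.
  + move=> x _; rewrite sumEFin lee_fin.
    rewrite (eq_bigr (fun i => (`[< F i x >] : nat)%:R)%R); last first.
      by move=> i _; rewrite indicE; congr (_%:R); rewrite unfold_in.
    by rewrite -natr_sum ler_nat.
- by move=> i; apply/measurable_EFinP; exact: measurable_indic.
Qed.

End FiniteCovers.

(** * Integrals of essentially bounded functions over sets of finite measure *)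

Section LinftyIntegral.
Variables (R : realType) (G : topologicalGroupType).
Variable mu : {measure set (borelType G) -> \bar R}.
Hypothesis mu_gt0 : (0 < mu setT)%E.
Implicit Types (f : borelType G -> R) (A B : set (borelType G)).

Lemma Linfty_measurable f : f \in Lfun mu +oo%E -> measurable_fun setT f.
Proof. by move=> /sub_Lfun_mfun; rewrite inE. Qed.

Lemma Linfty_bound f : f \in Lfun mu +oo%E ->
  exists2 M, 0 <= M & {ae mu, forall x, `|f x| <= M}.
Proof.
move=> /sub_Lfun_finLfun; rewrite inE /= /finite_norm unlock mu_gt0.
move=> /ereal_inf_lt[[r| |] /= aef]; rewrite ?ltxx// => _.
  exists (Num.max r 0); first by rewrite le_max lexx orbT.
  by apply: filterS aef => x; rewrite /= lee_fin => fr; rewrite le_max fr.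
(* The essential bound -oo holds at no point, so any real bound follows from it. *)
by exists 0 => //; apply: filterS aef => x.
Qed.

Lemma Linfty_integrable f A : f \in Lfun mu +oo%E -> measurable A ->
  (mu A < +oo)%E -> mu.-integrable A (EFin \o f).
Proof.
move=> fL mA Aoo; have [M M0 aef] := Linfty_bound fL.
have mf := measurable_funTS (D := A) (Linfty_measurable fL).
apply/integrableP; split; first exact/measurable_EFinP.
apply: (@le_lt_trans _ _ (\int[mu]_(x in A) M%:E)%E).
  apply: ae_ge0_le_integral => //.
  - by apply/measurable_EFinP; exact: measurableT_comp.
  - by apply: filterS aef => x fM _; rewrite /= lee_fin.
by rewrite integral_cst// lte_mul_pinfty.
Qed.

Lemma Linfty_Rintegral_le f A M : f \in Lfun mu +oo%E -> measurable A ->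
  (mu A < +oo)%E -> 0 <= M -> {ae mu, forall x, `|f x| <= M} ->
  `|\int[mu]_(x in A) f x| <= M * fine (mu A).
Proof.
move=> fL mA Aoo M0 aef; have intf := Linfty_integrable fL mA Aoo.
apply: le_trans (le_normr_Rintegral mA intf) _.
rewrite -[leRHS](Rintegral_cst mu mA) /Rintegral; apply: fine_le.
- by have := integrable_norm intf; exact: integrable_fin_num.
- by rewrite integral_cst// ge0_fin_numE ?mule_ge0// lte_mul_pinfty.
apply: ae_ge0_le_integral => //.
- apply/measurable_EFinP; apply: measurableT_comp => //.
  exact: measurable_funTS (Linfty_measurable fL).
- by apply: filterS aef => x fM _; rewrite /= lee_fin.
Qed.

Lemma Rintegral_setD f A B : f \in Lfun mu +oo%E -> measurable A -> measurable B ->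
  (mu A < +oo)%E ->
  \int[mu]_(x in A) f x = \int[mu]_(x in A `&` B) f x + \int[mu]_(x in A `\` B) f x.
Proof.
move=> fL mA mB Aoo; rewrite -[in LHS](setUIDK A B) Rintegral_setU//.
- exact: measurableI.
- exact: measurableD.
- by rewrite setUIDK; exact: Linfty_integrable.
- by apply/disj_setPS => x [[_ Bx] [_]].
Qed.

End LinftyIntegral.

Section HaarShift.
Variables (R : realType) (G : topologicalGroupType).
Variable mu : {measure set (borelType G) -> \bar R}.
Hypothesis haar_mu : left_haar_measure mu.
Implicit Types (A : set (borelType G)) (g : G).

Definition lshift g (y : borelType G) : borelType G := (g * (y : G))%g.

Lemma measurable_lshift g : measurable_fun setT (lshift g).
Proof.
move=> mT.
apply: (measurability _ (erefl : @measurable _ (borelType G) = <<s @open G >>)) => //.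
move=> _ [A oA <-]; rewrite setTI; apply: open_measurable_borel.
exact: open_mulgl.
Qed.

Lemma measurable_lshift_preimage g A : measurable A -> measurable (lshift g @^-1` A).
Proof. by move=> mA; rewrite -[X in measurable X]setTI; exact: measurable_lshift. Qed.

Lemma haar_lshift g A : measurable A -> mu (lshift g @^-1` A) = mu A.
Proof.
case: haar_mu => _ _ inv mA; rewrite -(inv (g^-1)%g A mA); congr (mu _).
by have := lmulsetE (g^-1)%g (A : set G); rewrite invgK => /esym.
Qed.

(** Invariance of [mu] keeps null sets null under translation, so an essential bound carries
    over. *)
Lemma Linfty_lshift g (f : borelType G -> R) :
  f \in Lfun mu +oo%E -> f \o lshift g \in Lfun mu +oo%E.
Proof.
have mu_gt0 : (0 < mu setT)%E by case: haar_mu.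
move=> fL; have mf := Linfty_measurable fL.
have [M M0 [N [mN muN fN]]] := Linfty_bound mu_gt0 fL.
rewrite inE; apply/andP; split; rewrite inE /=.
  by apply: measurableT_comp => //; exact: measurable_lshift.
rewrite /finite_norm unlock mu_gt0; apply: (@le_lt_trans _ _ M%:E); last exact: ltry.
apply/ess_supP; exists (lshift g @^-1` N); split.
- exact: measurable_lshift_preimage.
- by rewrite haar_lshift.
- by move=> x /= nx; apply: fN => fM; apply: nx; rewrite lee_fin.
Qed.

Lemma haar_Rintegral_lshift g A (f : borelType G -> R) :
  f \in Lfun mu +oo%E -> measurable A -> (mu A < +oo)%E ->
  \int[mu]_(x in A) f (lshift (g^-1)%g x) = \int[mu]_(x in lshift g @^-1` A) f x.
Proof.
have mu_gt0 : (0 < mu setT)%E by case: haar_mu.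
move=> fL mA Aoo; have mf := Linfty_measurable fL.
have mAg := measurable_lshift_preimage g mA.
have AgA : lshift (g^-1)%g @^-1` (lshift g @^-1` A) = A.
  by apply/seteqP; split=> x; rewrite /lshift /= mulVKg.
have intf : mu.-integrable (lshift g @^-1` A) (EFin \o f).
  by apply: Linfty_integrable => //; rewrite haar_lshift.
have fgL : f \o lshift (g^-1)%g \in Lfun mu +oo%E by exact: Linfty_lshift.
congr fine; transitivity (\int[mu]_(x in lshift (g^-1)%g @^-1` (lshift g @^-1` A))
    ((EFin \o f) \o lshift (g^-1)%g) x)%E; first by rewrite AgA.
rewrite -(integral_pushforward (measurable_lshift (g^-1)%g))//.
- apply: eq_measure_integral => [|mphi B mB _]; first exact: measurable_lshift.
  exact: haar_lshift.
- exact/measurable_EFinP.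
- by rewrite AgA; exact: Linfty_integrable fgL _ _.
Qed.

End HaarShift.

(** * Averages over thickened Folner sets *)

Section FolnerMean.
Variables (R : realType) (G : topologicalGroupType) (L Q : set G) (C : nat).
Hypothesis win : window L Q C.
Variable mu : {measure set (borelType G) -> \bar R}.
Hypothesis haar_mu : left_haar_measure mu.
Hypotheses (Q_gt0 : (0 < mu Q)%E) (Q_fin : (mu Q < +oo)%E).

(** This is the right translate Q e^-1. *)
Definition rtrans (e : G) : set (borelType G) := [set y : G | Q (y * e)%g].

Lemma measurable_rtrans e : measurable (rtrans e).
Proof. by apply: open_measurable_borel; exact: (open_mulgr e (winQ_open win)). Qed.

Lemma rtrans1 : rtrans 1%g = Q.
Proof. by apply/seteqP; split=> y; rewrite /rtrans /= mulg1. Qed.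

(* The same double counting as in [mean_rhits_translate]; it says that the
   modular function of G is bounded. *)
Lemma haar_rtrans_le e e' : (mu (rtrans e) <= C%:R%:E * mu (rtrans e'))%E.
Proof.
have [K [KL KP]] := win_finite win (e'^-1 * e)%g.
pose F (k : G) := rtrans e `&` lshift k @^-1` rtrans e'.
have mF k : measurable (F k).
  apply: measurableI; first exact: measurable_rtrans.
  by apply: measurable_lshift_preimage; exact: measurable_rtrans.
apply: (@le_trans _ _ (\sum_(k <- K) mu (F k))%E).
  apply: measure_cover_le => // [|z Qze]; first exact: measurable_rtrans.
  have [x Lx Qx] := win_cover win ((z * e')^-1)%g.
  have Qx' : Q (x^-1 * (z * e'))%g by have := winQV win Qx; rewrite invgM invgK.
  have Lx' := winV win Lx.
  exists (x^-1)%g; last by split=> //; rewrite /rtrans /lshift /= -mulgA.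
  apply: KP Lx' Qx' _; rewrite -mulgA mulVKg; exact: Qze.
(* Left invariance replaces [F k] by its translate k F k. The latter lies in [rtrans e'], and a
   point y belongs to it for at most [C] values of k, as (y e)^-1 k must lie in Q. *)
pose F' (k : G) := lshift (k^-1)%g @^-1` F k.
rewrite (eq_bigr (fun k => mu (F' k))); last by move=> k _; rewrite haar_lshift.
apply: measure_multiplicity_le.
- exact: measurable_rtrans.
- by move=> k; apply: measurable_lshift_preimage.
- by move=> k y [_]; rewrite /lshift /rtrans /= mulVKg.
- move=> y; have [E [EC EP]] := win_count win ((y * e : G)^-1)%g.
  apply: leq_trans EC; apply: sum_bool_le => k kK [Qk _].
  apply: EP; first exact: KL.
  by have := winQV win Qk; rewrite /lshift /= !invgM invgK !mulgA.
Qed.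

(** This is the set W = Q F^-1, the union of the [rtrans x] for x in F. *)
Definition thicken (F : {fset G}) : set (borelType G) :=
  [set y : G | exists2 x, x \in F & Q (y * x)%g].

Lemma measurable_thicken F : measurable (thicken F).
Proof.
apply: open_measurable_borel; rewrite (_ : thicken F = \bigcup_(x in [set` F]) rtrans x).
  by apply: bigcup_open => x _; apply: open_mulgr; exact: winQ_open win.
by apply/seteqP; split=> y [x xF Qx]; exists x.
Qed.

Let q : R := fine (mu Q).

Let muQ : mu Q = q%:E.
Proof. by rewrite fineK// ge0_fin_numE. Qed.

Let q_gt0 : 0 < q. Proof. by rewrite -lte_fin -muQ. Qed.

Let sum_cst (F : {fset G}) (a : R) : (\sum_(x <- F) a%:E)%E = (#|` F|%fset%:R * a)%:E.
Proof. by rewrite sumEFin big_const_seq count_predT iter_addr_0 mulr_natl. Qed.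

Lemma haar_cover_le (F : {fset G}) (A : set (borelType G)) : measurable A ->
  A `<=` thicken F -> (mu A <= (#|` F|%fset%:R * (C%:R * q))%:E)%E.
Proof.
move=> mA AF.
have covA y : A y -> exists2 x, x \in enum_fset F & rtrans x y.
  by move=> /AF[x]; exists x.
apply: le_trans (measure_cover_le mu mA measurable_rtrans covA) _.
rewrite -sum_cst; apply: lee_sum => x _.
by rewrite EFinM -muQ -rtrans1; exact: haar_rtrans_le.
Qed.

Lemma haar_thicken_fin (F : {fset G}) : (mu (thicken F) < +oo)%E.
Proof.
apply: le_lt_trans (haar_cover_le (measurable_thicken F) (@subset_refl _ _)) _.
exact: ltry.
Qed.

(** One factor [C] compares Q with each Q x^-1; the other bounds the multiplicity with which these
    translates cover [thicken F]. *)
Lemma haar_thicken_ge (F : {fset G}) : (forall x, x \in F -> L x) ->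
  #|` F|%fset%:R * q <= C%:R * C%:R * fine (mu (thicken F)).
Proof.
move=> FL; rewrite -lee_fin.
have thickE : mu (thicken F) = (fine (mu (thicken F)))%:E.
  by rewrite fineK// ge0_fin_numE//; exact: haar_thicken_fin.
apply: (@le_trans _ _ (C%:R%:E * \sum_(x <- F) mu (rtrans x))%E).
  rewrite ge0_sume_distrr// -sum_cst; apply: lee_sum => x _.
  by rewrite -muQ -rtrans1; exact: haar_rtrans_le.
rewrite -mulrA EFinM EFinM -thickE lee_wpmul2l//.
(* Truncation outside [F] makes the inclusion in [thicken F] hold for every index, as
   [measure_multiplicity_le] requires. *)
pose A x : set (borelType G) := if x \in F then rtrans x else set0.
rewrite big_seq (eq_bigr (fun x => mu (A x))); last first.
  by move=> x xF; rewrite /A xF.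
rewrite -big_seq; apply: measure_multiplicity_le.
- exact: measurable_thicken.
- by move=> x; rewrite /A; case: ifP => // _; exact: measurable_rtrans.
- by move=> x y; rewrite /A; case: ifPn => // xF Qx; exists x.
- move=> y; have [E [EC EP]] := win_count win y.
  apply: leq_trans EC; apply: sum_bool_le => x xF; rewrite /A xF => Qx.
  by apply: EP => //; exact: FL.
Qed.

Variable d : G -> G -> R.
Hypothesis metd : is_metric_on L d.
(** Points of L seen through Q from z and from g z are at bounded distance; [QI_coarse] supplies
    this bound. *)
Hypothesis coarse : forall g : G, exists2 r : R, 0 < r & forall x x' (z : G),
  L x -> L x' -> Q (z * x)%g -> Q (g * z * x')%g -> d x x' < r.

Let dxx x : L x -> d x x = 0.
Proof. by case: metd => _ + _ _ Lx => /(_ x x Lx Lx)[_ ->]. Qed.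

Let d_sym x y : L x -> L y -> d x y = d y x.
Proof. by case: metd => _ _ + _; apply. Qed.

(** Let y lie in exactly one of W and g^-1 W. One of y and g y then sees a point of F through Q, and
    the other sees a point of L, necessarily outside F. By [coarse] the two points are within r, so
    the one seen from y is in the r-boundary of F. *)
Lemma thicken_boundary (g : G) : exists2 r : R, 0 < r &
  forall (F B : {fset G}), (forall x, x \in F -> L x) ->
    (forall x, folner_boundary L d r [set` F] x -> x \in B) ->
    lshift g @^-1` thicken F `\` thicken F `<=` thicken B /\
    thicken F `\` lshift g @^-1` thicken F `<=` thicken B.
Proof.
have [r r0 rP] := coarse g; exists r => // F B FL FB; split=> y.
  move=> [[x xF Qx] nFy]; have Lx := FL x xF.
  have [x' Lx' Qx'] := win_cover win y.
  have dx : d x' x < r by apply: rP Qx' Qx.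
  exists x' => //; apply: FB; apply/folner_boundaryP; split=> //.
    by exists x.
  exists x'; last by rewrite dxx.
  by split=> // x'F; apply: nFy; exists x'.
move=> [[x xF Qx] nFy]; have Lx := FL x xF.
have [x' Lx' Qx'] := win_cover win (g * y)%g.
have dx : d x x' < r by apply: rP Qx Qx'.
exists x => //; apply: FB; apply/folner_boundaryP; split=> //.
  by exists x => //; rewrite dxx.
by exists x' => //; split=> // x'F; apply: nFy; exists x'.
Qed.

Let mu_gt0 : (0 < mu setT)%E. Proof. by case: haar_mu. Qed.

Definition avg (F : {fset G}) (f : borelType G -> R) : R :=
  (\int[mu]_(x in thicken F) f x) / fine (mu (thicken F)).

Lemma fine_thicken_gt0 (F : {fset G}) : (forall x, x \in F -> L x) -> F != fset0 ->
  0 < fine (mu (thicken F)).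
Proof.
move=> FL F0; rewrite lt_neqAle fine_ge0// andbT eq_sym; apply/eqP => w0.
have := haar_thicken_ge FL; rewrite w0 mulr0; apply/negP; rewrite -ltNge.
by rewrite mulr_gt0// ltr0n cardfs_gt0.
Qed.

Lemma avg_bound (F : {fset G}) f M : (forall x, x \in F -> L x) -> F != fset0 ->
  f \in Lfun mu +oo%E -> 0 <= M -> {ae mu, forall x, `|f x| <= M} ->
  `|avg F f| <= M.
Proof.
move=> FL F0 fL M0 fM; have w0 := fine_thicken_gt0 FL F0.
rewrite /avg normrM normfV (gtr0_norm w0) ler_pdivrMr//.
exact: Linfty_Rintegral_le (measurable_thicken F) (haar_thicken_fin F) _ fM.
Qed.

(** The factor 2 counts the two halves of the symmetric difference of W and g^-1 W. Of the three
    factors [C], one comes from [haar_cover_le] applied to each half and two from [haar_thicken_ge]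
    applied to the denominator. *)
Lemma avg_shift (F B : {fset G}) (g : G) f M : (forall x, x \in F -> L x) -> F != fset0 ->
  f \in Lfun mu +oo%E -> 0 <= M -> {ae mu, forall x, `|f x| <= M} ->
  lshift g @^-1` thicken F `\` thicken F `<=` thicken B ->
  thicken F `\` lshift g @^-1` thicken F `<=` thicken B ->
  `|avg F (fun x => f (lshift (g^-1)%g x)) - avg F f| <=
    2 * M * C%:R ^+ 3 * (#|` B|%fset%:R / #|` F|%fset%:R).
Proof.
move=> FL F0 fL M0 fM FB1 FB2; have w0 := fine_thicken_gt0 FL F0.
have mF := measurable_thicken F.
have mgF := measurable_lshift_preimage g mF.
have Foo := haar_thicken_fin F.
have gFoo : (mu (lshift g @^-1` thicken F) < +oo)%E by rewrite haar_lshift.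
rewrite /avg -mulrBl haar_Rintegral_lshift//.
(* The integrals over the common part of W and g^-1 W cancel. *)
rewrite (Rintegral_setD mu_gt0 fL mgF mF gFoo) (Rintegral_setD mu_gt0 fL mF mgF Foo).
rewrite setIC opprD addrACA subrr add0r.
rewrite normrM normfV (gtr0_norm w0) ler_pdivrMr//.
have small A : measurable A -> A `<=` thicken B ->
    `|\int[mu]_(x in A) f x| <= M * (#|` B|%fset%:R * (C%:R * q)).
  move=> mA AB; have leA := haar_cover_le mA AB.
  have Aoo : (mu A < +oo)%E by apply: le_lt_trans leA _; exact: ltry.
  apply: le_trans (Linfty_Rintegral_le mu_gt0 fL mA Aoo M0 fM) _.
  by rewrite ler_wpM2l// -lee_fin fineK// ge0_fin_numE.
apply: le_trans (ler_normB _ _) _.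
apply: (@le_trans _ _ (2 * M * (#|` B|%fset%:R * (C%:R * q)))).
  rewrite -mulrA mulr_natl mulr2n; apply: lerD; apply: small => //; exact: measurableD.
have F_gt0 : 0 < #|` F|%fset%:R :> R by rewrite ltr0n cardfs_gt0.
have := haar_thicken_ge FL.
set n := #|` F|%fset%:R in F_gt0 *; set b := #|` B|%fset%:R; set w := fine _ in w0 *.
move=> qw; have b0 : 0 <= b by [].
have -> : 2 * M * C%:R ^+ 3 * (b / n) * w = 2 * M * (b * C%:R * ((C%:R * C%:R * w) / n)).
  by rewrite !exprS expr0; ring.
rewrite ler_wpM2l ?mulr_ge0//.
have -> : b * (C%:R * q) = b * C%:R * q by rewrite mulrA.
by rewrite ler_wpM2l ?mulr_ge0// ler_pdivlMr// mulrC.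
Qed.

(** The n-th Folner set has scale n + 1 and ratio below 1 / (n + 1): the scale eventually exceeds
    the r attached to any given g, while the bound of [avg_shift] tends to 0. *)
Theorem mean_of_folner_amenable : folner_amenable L d ->
  exists m, left_invariant_mean mu m.
Proof.
move=> folnerL.
have /choice[F FP] n : exists F : {fset G}, [/\ forall x, x \in F -> L x, F != fset0 &
    exists B : {fset G}, (forall x, folner_boundary L d n.+1%:R [set` F] x -> x \in B) /\
      #|` B|%fset%:R / #|` F|%fset%:R < n.+1%:R^-1 :> R].
  have [A [AL finA A0 finB ltB]] := folnerL n.+1%:R n.+1%:R^-1 (ltr0Sn _ _)
    (ltac:(by rewrite invr_gt0)).
  exists (fset_set A); split.
  - by move=> x; rewrite in_fset_set// inE; exact: AL.
  - by case: A0 => x Ax; apply/fset0Pn; exists x; rewrite in_fset_set// inE.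
  - exists (fset_set (folner_boundary L d n.+1%:R A)); split=> //.
    by move=> x; rewrite fset_setK// in_fset_set// inE.
have FL n : forall x, x \in F n -> L x by case: (FP n).
have F0 n : F n != fset0 by case: (FP n).
pose m f := ulim (fun n => avg (F n) f); exists m.
have bnd f : f \in Lfun mu +oo%E -> useq_bounded (fun n => avg (F n) f).
  move=> fL; have [M M0 fM] := Linfty_bound mu_gt0 fL; exists M => n.
  exact: (avg_bound (FL n) (F0 n) fL M0 fM).
have int f n : f \in Lfun mu +oo%E -> mu.-integrable (thicken (F n)) (EFin \o f).
  move=> fL; apply: Linfty_integrable => //; first exact: measurable_thicken.
  exact: haar_thicken_fin.
split.
- move=> a f h fL hL.
  rewrite /m -(@ulimZ R a); last exact: bnd.
  rewrite -ulimD; [|by apply: useq_boundedZ; exact: bnd|exact: bnd].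
  congr ulim; apply/funext => n; rewrite /avg mulrA -mulrDl; congr (_ / _).
  rewrite -RintegralZl ?int//; last exact: measurable_thicken.
  have mF := measurable_thicken (F n).
  rewrite -RintegralD//; [|exact: int].
    have -> : EFin \o (fun x => a * f x) = (fun x => a%:E * (EFin \o f) x)%E by [].
    by apply: integrableZl; [exact: measurable_thicken|exact: int].
- move=> f fL f_ge0; rewrite -(ulim_cst (0 : R)); apply: ulim_le.
  + exact: useq_bounded_cst.
  + exact: bnd.
  + apply: nearW => n; rewrite /avg divr_ge0 ?fine_ge0//.
    have mF := measurable_thicken (F n).
    have mf := measurable_funTS (D := thicken (F n)) (Linfty_measurable fL).
    (* f is nonnegative only almost everywhere, so it is replaced by its absolute value. *)
    rewrite (@ae_eq_integral _ _ _ mu _ (fun x => `|f x|%:E)) ?integral_ge0//.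
    * by apply/measurable_EFinP.
    * by apply/measurable_EFinP; exact: measurableT_comp.
    * by apply: filterS f_ge0 => x fx _; rewrite /= ger0_norm.
- rewrite -[RHS](ulim_cst (1 : R)); congr ulim; apply/funext => n.
  rewrite /avg Rintegral_cst ?mul1r; last exact: measurable_thicken.
  by rewrite divff// gt_eqF//; exact: fine_thicken_gt0 (FL n) (F0 n).
- move=> g f fL; have [M M0 fM] := Linfty_bound mu_gt0 fL.
  have [r r0 rP] := thicken_boundary g.
  have fgL := Linfty_lshift haar_mu (g^-1)%g fL.
  pose u n := avg (F n) (fun x => f (lshift (g^-1)%g x)).
  suff : ulim (fun n => u n + -1 * avg (F n) f) = 0.
    rewrite ulimD ?ulimZ; [|exact: bnd|exact: (bnd _ fgL)|
      by apply: useq_boundedZ; exact: bnd].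
    by rewrite mulN1r => /subr0_eq.
  apply: ulim_cvg; apply: norm_cvg0.
  apply: (@squeeze_cvgr _ _ _ _ (fun=> 0) (fun n => 2 * M * C%:R ^+ 3 * n.+1%:R^-1)).
  + near=> n; rewrite normr_ge0 /= mulN1r.
    have [_ _ [B [FB ltB]]] := FP n.
    have [||FB1 FB2] := rP (F n) B; first exact: FL.
      move=> x /folner_boundaryP[Lx [y Fy xy] [z Fz xz]].
      (* Folner boundaries grow with the scale, so for n >= r the r-boundary of [F n] lies in
         [B]. *)
      have rn : r <= n.+1%:R.
        apply: (@le_trans _ _ n%:R); last by rewrite ler_nat.
        by near: n; exact: nbhs_infty_ger.
      apply: FB; apply/folner_boundaryP; split=> //.
        by exists y => //; exact: lt_le_trans rn.
      by exists z => //; exact: lt_le_trans rn.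
    apply: le_trans (avg_shift (FL n) (F0 n) fL M0 fM FB1 FB2) _.
    by rewrite ler_wpM2l ?mulr_ge0 ?exprn_ge0// ltW.
  + exact: cvg_cst.
  + rewrite -[X in _ --> X](mulr0 (2 * M * C%:R ^+ 3)); apply: cvgMr.
    exact: cvg_harmonic.
Unshelve. all: by end_near. Qed.

End FolnerMean.

(** * Conclusion *)

Section Assembly.
Variables (R : realType) (G : topologicalGroupType) (d : G -> G -> R).
Hypothesis admd : admissible_metric d.

(** If the r-ball were null, every ball would be null, being covered by finitely many left
    translates of it; then G, a countable union of balls, would be null too. *)
Lemma haar_dball_gt0 (mu : {measure set (borelType G) -> \bar R}) (r : R) :
  left_haar_measure mu -> 0 < r -> (0 < mu (dball d r))%E.
Proof.
move=> haar_mu r0; have [mu_gt0 _ _] := haar_mu.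
have mball s : measurable (dball d s : set (borelType G)).
  by apply: open_measurable_borel; exact: open_dball.
rewrite lt0e measure_ge0 andbT; apply/negP => /eqP ball0.
have balln n : mu (dball d n%:R) = 0%E.
  have [F FP] := totally_bounded_ball admd n%:R r0.
  apply/eqP; rewrite eq_le measure_ge0 andbT.
  apply: (@le_trans _ _ (\sum_(c <- F) mu (lshift (c^-1)%g @^-1` dball d r))%E).
    apply: measure_cover_le => // [c|x /ltW/FP[c cF cx]].
      exact: measurable_lshift_preimage.
    by exists c => //; rewrite /lshift /dball /= -admE.
  by rewrite big1// => c _; rewrite haar_lshift.
have : (mu setT <= \sum_(n <oo) mu (dball d n%:R))%E.
  apply: measure_sigma_subadditive => // x _.
  by exists (Num.trunc (dnorm d x)).+1 => //; exact: truncnS_gt.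
rewrite eseries0; last by move=> n _ _; exact: balln.
by rewrite leNgt mu_gt0.
Qed.

Variable L : set G.
Hypotheses (apxL : approximate_subgroup L) (delL : delone [set: G] d L).

Let symL : setinvg L = L. Proof. by case: apxL. Qed.

Lemma delone_window : exists2 r : R, 0 < r & exists C, window L (dball d r) C.
Proof.
have [r r0 cover_r] := window_cover admd delL; exists r => //.
have [C CP] := window_count admd delL r; exists C; split => //.
- exact: symLV.
- exact: open_dball.
- by move=> z; rewrite (dball_sym admd).
(* The radius comes from k = (k z) (z e e^-1)^-1, where k z and z e have norm below r. *)
- move=> e; pose K := [set k | L k /\ dball d (r + (r + dnorm d e)) (1 * k)%g].
  have finK : finite_set K by exact: finite_window.
  exists (fset_set K); split=> [k|k z Lk Qkz Qze].
    by rewrite in_fset_set// inE => -[].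
  rewrite in_fset_set// inE; split=> //; rewrite mul1g /dball /=.
  have -> : k = (k * z * ((z * e) * e^-1)^-1)%g by rewrite !mulgK.
  apply: le_lt_trans (dnormM admd _ _) _; apply: ltrD => //.
  rewrite dnormV//; apply: le_lt_trans (dnormM admd _ _) _.
  by rewrite dnormV// ltrD2r.
Qed.

Variables (S : set G) (dL : G -> G -> R).
Hypotheses (finS : finite_set S) (genS : generated S = generated L).
Hypothesis QIdL : quasi_isometry L (word_metric R S) L dL id.

(** The quotient x^-1 x' equals (z x)^-1 g^-1 (g z x'), so it has bounded norm. By symmetry of L it
    lies in L L, hence in a finite set, and [QI_finite] applies. *)
Lemma QI_coarse (r : R) (g : G) : exists2 s : R, 0 < s & forall x x' z,
  L x -> L x' -> dball d r (z * x)%g -> dball d r (g * z * x')%g -> dL x x' < s.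
Proof.
have fin := finite_window_mul admd delL apxL (r + (dnorm d g + r)).
have [s s0 sP] := QI_finite QIdL fin; exists s => // x x' z Lx Lx' Qx Qx'.
apply: sP => //; split; first by exists (x^-1)%g; [exact: symLV|exists x'].
rewrite /dball /=.
have -> : (x^-1 * x' = (z * x)^-1 * (g^-1 * (g * z * x')))%g.
  by rewrite -!mulgA mulKg invgM -!mulgA mulKg.
apply: le_lt_trans (dnormM admd _ _) _; rewrite dnormV// ltrD//.
by apply: le_lt_trans (dnormM admd _ _) _; rewrite dnormV// ltrD2l.
Qed.

End Assembly.

Theorem corollary1p14 (R : realType) (G : topologicalGroupType)
    (lcscG : lcsc G) (cgG : compactly_generated G) (L : set G)
    (latL : uniform_approximate_lattice R L) (d : G -> G -> R)
    (QId : canonical_QI_class L d) :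
  metrically_amenable L d <-> amenable R G.
Proof.
have [hausG _ _] := lcscG.
have [apxL [dG admG delL]] := latL.
have [metd [S [finS genS QIS]]] := QId.
have [r r0 [C win]] := delone_window admG apxL delL.
(* Balls of L are finite, so metric amenability is the existence of Folner sets in L itself. *)
rewrite (QI_metrically_amenable finS genS QIS).
split=> [folnerL|[mu _ [m mean_m]]]; last first.
  exact: (folner_amenable_of_mean finS genS QIS metd win mean_m).
have [mu haar_mu] := left_haar_measure_exists admG hausG; exists mu => //.
have Q_gt0 := haar_dball_gt0 admG haar_mu r0.
have Q_fin : (mu (dball dG r) < +oo)%E.
  have [_ fin _] := haar_mu.
  apply: (@le_lt_trans _ _ (mu [set y : G | dG 1%g y <= r])); last first.
    exact/fin/(compact_adm_ball admG).
  apply: le_measure; rewrite ?inE; last by move=> x; exact: ltW.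
    by apply: open_measurable_borel; exact: open_dball.
  rewrite -[X in measurable X]setCK; apply: measurableC.
  apply: open_measurable_borel; rewrite openC.
  by apply: compact_closed => //; exact: compact_adm_ball.
apply: (mean_of_folner_amenable win haar_mu Q_gt0 Q_fin metd) folnerL => g.
exact: (QI_coarse admG apxL delL QIS).
Qed.
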